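(* Let $N=N^{n+1}$ be a semi-Riemannian manifold and $M=M^n$ a smooth, connected, complete, orientable manifold. Suppose $x\colon M\times(0,T^* )\to N$ is a family of strictly convex embeddings satisfying $$\dot x=-\sigma f\nu,$$ where $f\colon M\times(0,T^* )\to\mathbb{R}$ is a smooth and nowhere vanishing function. Assume that $q\in C^0((0,T^* ))$. Then $$\begin{cases}\dfrac{\partial_tf-h(\operatorname{grad}_hf,\operatorname{grad}_hf)}{f}\ge-q(t), & \text{if } f>0,\\[2mm] \dfrac{\partial_tf-h(\operatorname{grad}_hf,\operatorname{grad}_hf)}{f}\le-q(t), & \text{if } f<0,\end{cases}$$ holds on $M\times(0,T^* )$ if and only if for all $x_1,x_2\in M$ and $t_2>t_1>0$ (with $t_2<T^*$) there holds $$f(x_1,t_1)\le\frac{e^{Q(t_2)}}{e^{Q(t_1)}}\,e^{\Delta/4}f(x_2,t_2),$$ where $Q(t_2)-Q(t_1)=\int_{t_1}^{t_2}q(t)\,dt$, $$\Delta=\begin{cases}\inf_\gamma\int_{t_1}^{t_2}\frac1f h(\dot\gamma,\dot\gamma)\,dt, & \text{if } f>0,\\ \sup_\gamma\int_{t_1}^{t_2}\frac1f h(\dot\gamma,\dot\gamma)\,dt, & \text{if } f<0,\end{cases}$$ and the infimum and supremum are taken over all smooth curves $\gamma\colon[t_1,t_2]\to M$ with $\gamma(t_i)=x_i$, $i=1,2$ (in the integrals, $f$ and $h$ are evaluated at $(\gamma(t),t)$). In particular, for $f>0$ and $p\ne-1$, $$\frac{\partial_tf-h(\operatorname{grad}_hf,\operatorname{grad}_hf)}{f}\ge-\frac{p}{p+1}\frac1t$$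 on $M\times(0,T^* )$ if and only if for all $x_1,x_2\in M$ and $0<t_1<t_2<T^*$ $$f(x_1,t_1)\le\left(\frac{t_2}{t_1}\right)^{\frac{p}{p+1}}e^{\Delta/4}f(x_2,t_2).$$
   Context: $\nu$ is a unit normal field along $x(M,t)$ with $\sigma=\bar g(\nu,\nu)\in\{1,-1\}$, where $\bar g$ is the metric of $N$. The second fundamental form $h$ is defined by $\bar\nabla_{x_*X}(x_*Y)=x_*(\nabla_XY)-\sigma h(X,Y)\nu$, where $\bar\nabla$ and $\nabla$ are the Levi-Civita connections of $\bar g$ and of the induced metric. Strictly convex means that (for the choice of $\nu$ used) $h$ is positive definite. $\operatorname{grad}_hf$ is defined by $h(\operatorname{grad}_hf,X)=df(X)$ for all $X\in TM$. *)

(* Defs.v *)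
From HB Require Import structures.
From mathcomp Require Import all_boot all_order all_algebra.
From mathcomp Require Import all_classical all_reals all_analysis.

Set Implicit Arguments.
Unset Strict Implicit.
Unset Printing Implicit Defensive.

Import Order.TTheory GRing.Theory Num.Theory.
Import numFieldNormedType.Exports.

Local Open Scope classical_set_scope.
Local Open Scope ring_scope.

(* C^k and C^oo maps between (finite-dimensional) normed spaces.  The set [U]
   is always meant to be open, since ['D_v] looks at full neighbourhoods; the
   same holds for the sets [U] below. *)
Fixpoint Ck_on (R : realType) (V W : normedModType R) (k : nat)
    (U : set V) (f : V -> W) : Prop :=
  (forall z, U z -> {for z, continuous f}) /\
  if k is k'.+1 then
    forall v, (forall z, U z -> derivable f z v) /\
              Ck_on k' U (fun z => 'D_v f z)
  else True.

Definition Coo_on (R : realType) (V W : normedModType R)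
  (U : set V) (f : V -> W) : Prop := forall k, Ck_on k U f.

(* A chart is a partial homeomorphism: [coord] matters only on [dom], and [inv]
   only on [coord @` dom] (see [is_chart]). *)
Record chart (R : realType) (E : normedModType R) (M : topologicalType) :=
  Chart { dom : set M; coord : M -> E; inv : E -> M }.

(* An atlas together with a preferred chart around each point.  The tangent
   space at [p] is the model space [E]: a tangent vector at [p] is given by its
   components in the chart [chart_at p]. *)
Record smooth_structure (R : realType) (E : normedModType R)
  (M : topologicalType) :=
  SmoothStructure { atlas : set (chart E M); chart_at : M -> chart E M }.

Section Manifolds.
Context {R : realType}.

Definition is_chart (E : normedModType R) (M : topologicalType)
    (c : chart E M) : Prop :=
  [/\ open (dom c), open (coord c @` dom c),
      (forall p, dom c p -> inv c (coord c p) = p),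
      (forall p, dom c p -> {for p, continuous (coord c)}) &
      (forall z, (coord c @` dom c) z -> {for z, continuous (inv c)})].

Definition chart_compat (E : normedModType R) (M : topologicalType)
    (c d : chart E M) : Prop :=
  Coo_on (coord c @` (dom c `&` dom d)) (coord d \o inv c).

Definition is_smooth_manifold (E : normedModType R) (M : topologicalType)
    (A : smooth_structure E M) : Prop :=
  [/\ hausdorff_space M, @second_countable M,
      (forall c, atlas A c -> is_chart c),
      (forall c d, atlas A c -> atlas A d -> chart_compat c d) &
      (forall p, atlas A (chart_at A p) /\ dom (chart_at A p) p)].

Definition line : smooth_structure R^o R :=
  let c := Chart (setT : set R) (id : R -> R^o) (id : R^o -> R) in
  SmoothStructure [set c] (fun=> c).

Definition prod_chart (E F : normedModType R) (M N : topologicalType)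
    (c : chart E M) (d : chart F N) : chart (E * F)%type (M * N)%type :=
  Chart (dom c `*` dom d) (fun pq => (coord c pq.1, coord d pq.2))
        (fun zw => (inv c zw.1, inv d zw.2)).

Definition prod_structure (E F : normedModType R) (M N : topologicalType)
    (A : smooth_structure E M) (B : smooth_structure F N) :
    smooth_structure (E * F)%type (M * N)%type :=
  SmoothStructure
    [set e | exists c d, [/\ atlas A c, atlas B d & e = prod_chart c d]]
    (fun pq => prod_chart (chart_at A pq.1) (chart_at B pq.2)).

Definition smooth_on (E F : normedModType R) (M N : topologicalType)
    (A : smooth_structure E M) (B : smooth_structure F N)
    (U : set M) (f : M -> N) : Prop :=
  (forall p, U p -> {for p, continuous f}) /\
  forall c d, atlas A c -> atlas B d ->
    Coo_on (coord c @` (dom c `&` U `&` f @^-1` dom d))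
           (coord d \o f \o inv c).

Definition vdiff (E F : normedModType R) (M : topologicalType)
    (A : smooth_structure E M) (f : M -> F) (p : M) (u : E) : F :=
  'D_u (f \o inv (chart_at A p)) (coord (chart_at A p) p).

Definition mdiff (E F : normedModType R) (M N : topologicalType)
    (A : smooth_structure E M) (B : smooth_structure F N)
    (f : M -> N) (p : M) (u : E) : F :=
  vdiff A (coord (chart_at B (f p)) \o f) p u.

Definition velocity (E : normedModType R) (M : topologicalType)
    (A : smooth_structure E M) (gamma : R -> M) (s : R) : E :=
  mdiff line A gamma s 1.

(* [comps] turns a tangent vector at [p] (given in [chart_at p]) into its
   components in the chart [c]; [tvec] is the inverse operation. *)
Definition comps (E : normedModType R) (M : topologicalType)
    (A : smooth_structure E M) (c : chart E M) (p : M) (u : E) : E :=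
  vdiff A (coord c) p u.

Definition tvec (E : normedModType R) (M : topologicalType)
    (A : smooth_structure E M) (c : chart E M) (p : M) (w : E) : E :=
  'D_w (coord (chart_at A p) \o inv c) (coord c p).

(* Smooth vector fields along a map [f], i.e. [V p] in T_(f p)N; ordinary
   vector fields are the case [f = id]. *)
Definition smooth_field_on (E F : normedModType R) (M N : topologicalType)
    (A : smooth_structure E M) (B : smooth_structure F N)
    (U : set M) (f : M -> N) (V : M -> F) : Prop :=
  forall c d, atlas A c -> atlas B d ->
    Coo_on (coord c @` (dom c `&` U `&` f @^-1` dom d))
           (fun z => comps B d (f (inv c z)) (V (inv c z))).

Definition is_embedding (E F : normedModType R) (M N : topologicalType)
    (A : smooth_structure E M) (B : smooth_structure F N)
    (f : M -> N) : Prop :=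
  [/\ smooth_on A B setT f,
      (forall p, injective (mdiff A B f p)),
      injective f &
      (forall U : set M, open U -> exists2 V : set N, open V & U = f @^-1` V)].

Definition orientable (n : nat) (M : topologicalType)
    (A : smooth_structure 'rV[R]_n M) : Prop :=
  exists B : set (chart 'rV[R]_n M),
    [/\ (forall c, B c -> is_chart c),
        (forall c d, B c -> atlas A d -> chart_compat c d /\ chart_compat d c),
        (forall p, exists2 c, B c & dom c p) &
        (forall c d, B c -> B d ->
           forall z, (coord c @` (dom c `&` dom d)) z ->
             0 < \det (jacobian (coord d \o inv c) z))].

Definition bilinear_form (E : normedModType R) (b : E -> E -> R) : Prop :=
  (forall u, scalar (b u)) /\ (forall v, scalar (b^~ v)).

Definition tensor_in (E : normedModType R) (M : topologicalType)
    (A : smooth_structure E M) (g : M -> E -> E -> R) (c : chart E M)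
    (z u v : E) : R :=
  g (inv c z) (tvec A c (inv c z) u) (tvec A c (inv c z) v).

(* [k] is the largest dimension of a subspace (the row space of [W]) on which
   [b] is negative definite. *)
Definition has_index (n : nat) (b : 'rV[R]_n -> 'rV[R]_n -> R) (k : nat) :
    Prop :=
  let negdef (W : 'M[R]_n) :=
    forall u : 'rV[R]_n, (u <= W)%MS -> u != 0 -> b u u < 0 in
  (exists2 W, negdef W & \rank W = k) /\
  (forall W, negdef W -> (\rank W <= k)%N).

Definition is_semi_riemannian (n : nat) (M : topologicalType)
    (A : smooth_structure 'rV[R]_n M)
    (g : M -> 'rV[R]_n -> 'rV[R]_n -> R) : Prop :=
  [/\ (forall p, bilinear_form (g p) /\ forall u v, g p u v = g p v u),
      (forall p u, (forall v, g p u v = 0) -> u = 0),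
      (exists k, forall p, has_index (g p) k) &
      (forall c u v, atlas A c ->
         Coo_on (coord c @` dom c) (fun z => tensor_in A g c z u v : R^o))].

(* An affine connection is given by its Christoffel symbols in each chart:
   [G c z u v] is the component vector of nabla_u v at the point with
   coordinates [z], for [u], [v] with constant components in [c].  The
   Levi-Civita connection is the torsion-free one for which [g] is parallel. *)
Definition is_levi_civita (E : normedModType R) (M : topologicalType)
    (A : smooth_structure E M) (g : M -> E -> E -> R)
    (G : chart E M -> E -> E -> E -> E) : Prop :=
  forall c z, atlas A c -> (coord c @` dom c) z ->
    [/\ (forall u, linear (G c z u)) /\ (forall v, linear ((G c z)^~ v)),
        (forall u v, G c z u v = G c z v u) &
        (forall u v w,
           'D_w (fun y => tensor_in A g c y u v : R^o) z =
           tensor_in A g c z (G c z w u) v + tensor_in A g c z u (G c z w v))].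

(* Covariant derivative at [p], in the direction [u] of T_pM, of a vector field
   [V] along [f : M -> N], for the connection [G] of N.  It is computed in a
   chart [d] of N around [f p] and returned as an element of T_(f p)N. *)
Definition covariant (E F : normedModType R) (M N : topologicalType)
    (A : smooth_structure E M) (B : smooth_structure F N)
    (G : chart F N -> F -> F -> F -> F) (d : chart F N)
    (f : M -> N) (V : M -> F) (p : M) (u : E) : F :=
  tvec B d (f p)
    (vdiff A (fun q => comps B d (f q) (V q)) p u +
     G d (coord d (f p)) (comps B d (f p) (mdiff A B f p u))
         (comps B d (f p) (V p))).

Definition is_geodesic (E : normedModType R) (M : topologicalType)
    (A : smooth_structure E M) (G : chart E M -> E -> E -> E -> E)
    (gamma : R -> M) : Prop :=
  smooth_on line A setT gamma /\
  forall s d, atlas A d -> dom d (gamma s) ->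
    covariant line A G d gamma (velocity A gamma) s 1 = 0.

Definition geodesically_complete (E : normedModType R) (M : topologicalType)
    (A : smooth_structure E M) (G : chart E M -> E -> E -> E -> E) : Prop :=
  forall (p : M) (u : E), exists gamma : R -> M,
    [/\ is_geodesic A G gamma, gamma 0 = p & velocity A gamma 0 = u].

Definition pullback_metric (E F : normedModType R) (M N : topologicalType)
    (A : smooth_structure E M) (B : smooth_structure F N)
    (g : N -> F -> F -> R) (f : M -> N) (p : M) (u v : E) : R :=
  g (f p) (mdiff A B f p u) (mdiff A B f p v).

(* The Gauss formula nablabar_(f_*u) (f_*Y) = f_*(nabla_u Y) - sigma h(u,Y) nu,
   for vector fields [Y] defined near [p], so that no cut-off is involved. *)
Definition is_second_fundamental_form (E F : normedModType R)
    (M N : topologicalType)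
    (A : smooth_structure E M) (B : smooth_structure F N)
    (GM : chart E M -> E -> E -> E -> E) (GN : chart F N -> F -> F -> F -> F)
    (f : M -> N) (nu : M -> F) (sigma : R) (h : M -> E -> E -> R) : Prop :=
  forall (p : M) (u : E) (Y : M -> E) (U : set M) (c : chart E M)
    (d : chart F N),
    open U -> U p -> smooth_field_on A A U id Y ->
    atlas A c -> dom c p -> atlas B d -> dom d (f p) ->
    covariant A B GN d f (fun q => mdiff A B f q (Y q)) p u =
    mdiff A B f p (covariant A A GM c id Y p u) - (sigma * h p u (Y p)) *: nu p.

(* Smooth curves [t1, t2] -> M from [p1] to [p2]; smoothness on the closed
   interval means smoothness of an extension to a larger open interval. *)
Definition curves (E : normedModType R) (M : topologicalType)
    (A : smooth_structure E M) (t1 t2 : R) (p1 p2 : M) : set (R -> M) :=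
  [set gamma | [/\ gamma t1 = p1, gamma t2 = p2 &
     exists2 e : R, 0 < e &
       smooth_on line A [set s | t1 - e < s < t2 + e] gamma]].

Definition energy (E : normedModType R) (M : topologicalType)
    (A : smooth_structure E M) (f : M * R -> R) (h : M * R -> E -> E -> R)
    (t1 t2 : R) (gamma : R -> M) : \bar R :=
  \int[lebesgue_measure]_(s in `[t1, t2])
    ((f (gamma s, s))^-1 *
     h (gamma s, s) (velocity A gamma s) (velocity A gamma s))%:E.

(* A nowhere vanishing continuous [f] has constant sign on the connected
   M x (0,T), so the case distinction may be made at [(p1, t1)]. *)
Definition Delta (E : normedModType R) (M : topologicalType)
    (A : smooth_structure E M) (f : M * R -> R) (h : M * R -> E -> E -> R)
    (p1 p2 : M) (t1 t2 : R) : \bar R :=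
  let energies := energy A f h t1 t2 @` curves A t1 t2 p1 p2 in
  if 0 < f (p1, t1) then ereal_inf energies else ereal_sup energies.

Definition harnack_quotient (E : normedModType R) (M : topologicalType)
    (f : M * R -> R) (h : M * R -> E -> E -> R) (w : M * R -> E)
    (p : M) (t : R) : R :=
  (derive1 (fun s => f (p, s) : R^o) t - h (p, t) (w (p, t)) (w (p, t))) / f (p, t).

End Manifolds.

(* Main.v *)
(* Along a curve gamma the function L(s) = ln |f (gamma s, s)| + Q s satisfies
   L' = (d_t f + df (gamma')) / f + q, and df (gamma') = h (grad f, gamma').
   Completing the square h (grad f + gamma'/2, grad f + gamma'/2) >= 0, the
   differential inequality is equivalent to - 4 L' <= h (gamma', gamma') / f (for
   f > 0; reversed for f < 0) for all gamma, with equality in the square for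
   gamma' = - 2 grad f.  Integrating gives the Harnack inequality; conversely it
   is applied on [t, s] to the curve that is straight in a chart with velocity
   - 2 grad f, divided by s - t, and s tends to t.

   The tensor h is only given through the Gauss formula.  In charts it is
   h (u, v) = - g (D_u D_v x + Gamma (D_u x, D_v x), nu); it is symmetric by
   Schwarz's theorem, and Koszul's formula makes it continuous in time along the
   straight curves. *)
Require Import Defs.
From HB Require Import structures.
From mathcomp Require Import all_boot all_order all_algebra.
From mathcomp Require Import all_classical all_reals all_analysis.
From mathcomp Require Import ring lra.
(* Imported again because [vector.coord] shadows the projection [coord]. *)
Require Import Defs.

Set Implicit Arguments.
Unset Strict Implicit.
Unset Printing Implicit Defensive.

Import Order.TTheory GRing.Theory Num.Theory.
Import numFieldNormedType.Exports.

Local Open Scope classical_set_scope.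
Local Open Scope ring_scope.

(** * Differential calculus in finite dimension *)

(** The obstacle is regularity. [Ck_on] speaks only of directional derivatives, so total
    differentiability of C^1 maps, the chain rule and the stability of C^k under composition have to
    be obtained before anything can be moved between charts. Moreover, nothing is assumed about how
    [h] depends on the point or on time, nor about the regularity of the Christoffel symbols.
    Integrating therefore rests on a pointwise comparison of integrands, valid whatever their
    measurability. Differentiating uses continuity of the energy density at a single time along a
    single curve. A curve that is straight in a chart is chosen because its velocity has constant
    components there: only derivatives of x in one fixed direction enter, and the Christoffel term
    takes the diagonal form g (Gamma (a, a), nu), which Koszul's formula turns into first
    derivatives of the metric coefficients. Passing to logarithms also unifies the two signs of f:
    the Harnack inequality becomes - 4 (L t2 - L t1) <= Delta for f > 0 and the reverse for f < 0,
    where the 4 is that of exp (Delta / 4). *)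

Section Differentiability.
Context {R : realType}.
Implicit Types V W : normedModType R.

(** A directional derivative sees only the line through the point, so it can be transported along
    any [g] that maps this line affinely onto another one. This serves for restrictions to real
    lines, for slices of space-time at a fixed time or point, and for straight curves. *)
Lemma derive_affine V V' W (F : V -> W) (g : V' -> V) x v w :
  (forall h, g (h *: v + x) = h *: w + g x) ->
  ('D_v (F \o g) x = 'D_w F (g x)) *
  (derivable (F \o g) x v <-> derivable F (g x) w).
Proof.
move=> gE; rewrite /derive /derivable /=.
have -> : (fun h => h^-1 *: (F (g (h *: v + x)) - F (g x))) =
          (fun h => h^-1 *: (F (h *: w + g x) - F (g x))).
  by apply/funext => h; rewrite gE.
by split.
Qed.

(** On the line spanned by [v] derivability is differentiability in one variable, and the
    differential is homogeneous; [a = 0] is included. *)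
Lemma is_derive_dirZ V W (F : V -> W) z (v : V) (a : R) :
  derivable F z v -> is_derive z (a *: v) F (a *: 'D_v F z).
Proof.
move=> dF.
pose g (s : R) : V := s *: v + z.
have gE (w : R) h : g (h *: w + 0) = h *: (w *: v) + g 0.
  by rewrite /g scale0r add0r addr0 scalerA.
have g0 : g 0 = z by rewrite /g scale0r add0r.
have dg : differentiable (F \o g) 0.
  apply/derivable1_diffP; apply/(derive_affine F (gE 1)).2.
  by rewrite g0 scale1r.
have dga : derivable (F \o g) 0 a by exact: diff_derivable.
have -> : 'D_v F z = 'D_1 (F \o g) 0.
  by rewrite (derive_affine F (gE 1)).1 scale1r g0.
have -> : a *: 'D_1 (F \o g) 0 = 'D_a (F \o g) 0.
  rewrite !deriveE //.
  by rewrite -linearZ /= -[a in RHS]mulr1.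
rewrite (derive_affine F (gE a)).1 g0.
apply: derivableP; rewrite -g0.
exact/(derive_affine F (gE a)).2.
Qed.

Lemma mvt_line V (F : V -> R^o) (y v : V) :
  (forall s : R, 0 <= s <= 1 -> derivable F (s *: v + y) v) ->
  exists2 s : R, 0 <= s <= 1 & F (v + y) - F y = 'D_v F (s *: v + y).
Proof.
move=> dF.
pose g (s : R) : V := s *: v + y.
have gE (s h : R) : g (h *: 1 + s) = h *: v + g s.
  by rewrite /g scalerDl -addrA [_ *: 1]mulr1.
have dg (s : R) : 0 <= s <= 1 -> is_derive s 1 (F \o g : R -> R) ('D_v F (g s)).
  move=> s01; rewrite -(derive_affine F (gE s)).1; apply: derivableP.
  exact/(derive_affine F (gE s)).2/dF.
have [||s] := @MVT_segment R (F \o g) (fun s => 'D_v F (g s)) 0 1 ler01.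
- move=> s; rewrite in_itv /= => /andP[/ltW s0 /ltW s1].
  by apply: dg; rewrite s0 s1.
- apply: derivable_within_continuous => s; rewrite in_itv /= => s01.
  by have [] := dg _ s01.
rewrite in_itv /= => s01; rewrite subr0 mulr1 /g /= scale1r scale0r add0r => E.
by exists s.
Qed.

Lemma cvg_sum W (I T : Type) (r : seq I) (F : set_system T) (FF : Filter F)
    (f : I -> T -> W) (a : I -> W) :
  (forall i, f i x @[x --> F] --> a i) ->
  \sum_(i <- r) f i x @[x --> F] --> \sum_(i <- r) a i.
Proof.
by move=> fa; apply: cvg_big => //; exact: add_continuous.
Qed.

(** Vectors and coordinate functionals are indexed by all of [nat], so that partial sums can be
    handled by induction on [m] with [e] and [l] fixed. *)
Definition findim V := exists m (e : nat -> V) (l : nat -> {linear V -> R^o}),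
  (forall i, continuous (l i)) /\ forall h, h = \sum_(i < m) l i h *: e i.

Lemma linear_bound V (l : {linear V -> R^o}) : continuous l ->
  exists2 k : R, 0 < k & forall h, `|l h| <= k * `|h|.
Proof. by move=> lc; have [//|k k0 kP] := @linear_lipschitz _ _ _ l; exists k. Qed.

Lemma small_partial_sums V (e : nat -> V) (l : nat -> {linear V -> R^o}) m :
  (forall i, continuous (l i)) ->
  (fun h => \sum_(i < m) l i h *: e i) @ (0 : V) --> (0 : V).
Proof.
move=> lc.
elim: m => [|m IH].
  rewrite (_ : (fun _ => _) = cst 0); first exact: cvg_cst.
  by apply/funext => h; rewrite big_ord0.
rewrite (_ : (fun _ => _) = (fun h => \sum_(i < m) l i h *: e i + l m h *: e m)).
  rewrite -[X in _ --> X]addr0; apply: cvgD; first exact: IH.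
  rewrite -[X in _ --> X](scale0r (e m)).
  apply: cvgZr_tmp; rewrite -(linear0 (l m)); exact: lc.
by apply/funext => h; rewrite big_ord_recr.
Qed.

(** The classical step from continuous partial derivatives to a total differential: one coordinate
    is moved at a time, and each move is controlled by the mean value theorem on a segment that
    stays near [z]. *)
Lemma partial_expansion V (e : nat -> V) (l : nat -> {linear V -> R^o})
    (F : V -> R^o) (U : set V) z m :
  (forall i, continuous (l i)) -> open U -> U z ->
  (forall y v, U y -> derivable F y v) ->
  (forall v, {for z, continuous (fun y => 'D_v F y)}) ->
  forall eps : R, 0 < eps -> \forall h \near (0 : V),
   `|F (\sum_(i < m) l i h *: e i + z) - F z -
     \sum_(i < m) l i h * 'D_(e i) F z| <= eps * `|h|.
Proof.
move=> lc oU Uz dF cF; elim: m => [|m IH] eps eps0.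
  near=> h; rewrite !big_ord0 add0r !subrr normr0 mulr_ge0 //; exact: ltW.
have [k k0 kP] := linear_bound (lc m).
have e2 : 0 < eps / 2 by rewrite divr_gt0.
(* The new coordinate contributes an error of at most [|l m h| <= k * |h|] times this tolerance,
   that is [eps / 2 * |h|]; the induction hypothesis accounts for the other half. *)
have ek : 0 < eps / 2 / k by rewrite divr_gt0.
have : \forall y \near z, U y /\ `|'D_(e m) F z - 'D_(e m) F y| <= eps / 2 / k.
  apply: filterI; first exact: open_nbhs_nbhs.
  by have /cvgrPdist_le := cF (e m); apply.
move=> /nbhs_ballP[d /= d0 dP].
have d2 : 0 < d / 2 by rewrite divr_gt0.
have S1 := small_partial_sums e m lc.
have /cvgrPdist_lt/(_ _ d2) S1' := S1.
have S2 : (fun h => l m h *: e m) @ (0 : V) --> (0 : V).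
  rewrite -[X in _ --> X](scale0r (e m)).
  apply: cvgZr_tmp; rewrite -(linear0 (l m)); exact: lc.
have /cvgrPdist_lt/(_ _ d2) S2' := S2.
have IH' := IH _ e2.
near=> h.
have H1 : `|0 - \sum_(i < m) l i h *: e i| < d / 2 by near: h.
have H2 : `|0 - l m h *: e m| < d / 2 by near: h.
have H3 : `|F (\sum_(i < m) l i h *: e i + z) - F z -
     \sum_(i < m) l i h * 'D_(e i) F z| <= eps / 2 * `|h| by near: h.
rewrite !sub0r !normrN in H1 H2.
set y := \sum_(i < m) l i h *: e i + z.
have inball s : 0 <= s <= 1 -> ball z d (s *: (l m h *: e m) + y).
  move=> /andP[s0 s1]; rewrite -ball_normE /ball_ /= distrC /y addrA addrK.
  rewrite (splitr d) (le_lt_trans (ler_normD _ _)) // ltrD //.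
  by rewrite normrZ ger0_norm // (le_lt_trans _ H2) // ler_piMl.
have [s s01 sE] := @mvt_line V F y (l m h *: e m) (fun s s01 => dF _ _ (dP _ (inball s s01)).1).
have [Us sD] := dP _ (inball s s01).
rewrite !big_ord_recr /=.
rewrite (_ : \sum_(i < m) l i h *: e i + l m h *: e m + z = l m h *: e m + y); last first.
  by rewrite /y addrCA addrA.
have alg (a b c p q : R) : a - c - (p + q) = (b - c - p) + ((a - b) - q).
  by ring.
rewrite (alg _ (F y)) sE.
have [_ ->] := is_derive_dirZ (l m h) (dF _ (e m) Us).
rewrite (le_trans (ler_normD _ _)) // (splitr eps) mulrDl lerD //.
rewrite -[_ *: _]/(_ * _) -mulrBr normrM distrC.
rewrite (le_trans (ler_pM _ _ (kP h) sD)) //.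
suff -> : k * `|h| * (eps / 2 / k) = eps / 2 * `|h| by [].
by field; rewrite gt_eqF.
Unshelve. all: by end_near. Qed.

Lemma C1_differentiable_real V (F : V -> R^o) (U : set V) z :
  findim V -> open U -> Ck_on 1 U F -> U z -> differentiable F z.
Proof.
move=> [m [e [l [lc lE]]]] oU [_ F1] Uz.
pose L (h : V) : R^o := \sum_(i < m) l i h *: ('D_(e i) F z : R^o).
have Llin : linear L.
  move=> a u v; rewrite /L scaler_sumr -big_split; apply: eq_bigr => i _.
  by rewrite linearP scalerDl scalerA.
pose LL : {linear V -> R^o} := HB.pack L (GRing.isLinear.Build _ _ _ _ _ Llin).
have Lc : continuous LL.
  move=> h; apply: (@cvg_sum R^o _ _ _ _ _ (fun (i : 'I_m) h => l i h *: ('D_(e i) F z : R^o))) => i.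
  by apply: cvgZr_tmp; exact: lc.
suff dE : F \o shift z = cst (F z) + LL +o_ 0 id.
  apply/diff_locallyP; rewrite (diff_unique Lc dE); split => //.
apply/eqaddoP => eps eps0.
have := @partial_expansion V e l F U z m lc oU Uz
  (fun y v Uy => (F1 v).1 y Uy) (fun v => (F1 v).2.1 z Uz) eps eps0.
apply: filterS => h.
by rewrite -(lE h) opprD addrA.
Qed.

End Differentiability.

(** * Chain rule and symmetry of second derivatives *)

Section ChainRuleAndSchwarz.
Context {R : realType}.
Implicit Types V W : normedModType R.

Lemma findim_line : findim (R^o : normedModType R).
Proof.
pose idl : {linear R^o -> R^o} := idfun.
exists 1%N, (fun=> 1), (fun=> idl); split; first by move=> i h; exact: cvg_id.
by move=> h; rewrite big_ord1 [_ *: _]mulr1.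
Qed.

Lemma findim_rV n : findim ('rV[R]_n : normedModType R).
Proof.
(* Indices beyond [n] receive the functional and the vector 0. *)
pose l0 (i : nat) (h : 'rV[R]_n) : R^o := if insub i is Some j then h 0 j else 0.
have llin i : linear (l0 i).
  by move=> a u v; rewrite /l0; case: insub => [j|]; rewrite ?mxE ?scaler0 ?addr0.
pose l i : {linear 'rV[R]_n -> R^o} :=
  HB.pack (l0 i) (GRing.isLinear.Build _ _ _ _ _ (llin i)).
exists n, (fun i => if insub i is Some j then delta_mx 0 j else 0), l; split.
  move=> i; change (continuous (l0 i)); rewrite /l0; case: insub => [j|].
    exact: coord_continuous.
  exact: cst_continuous.
move=> h; rewrite [LHS]row_sum_delta; apply: eq_bigr => i _.
by rewrite /= /l0 valK.
Qed.

Lemma findim_prod V W : findim V -> findim W ->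
  findim ((V * W)%type : normedModType R).
Proof.
move=> [m [e [l [lc lE]]]] [m' [e' [l' [lc' lE']]]].
pose L0 i (h : V * W) : R^o := if (i < m)%N then l i h.1 else l' (i - m)%N h.2.
have Llin i : linear (L0 i).
  by move=> a u v; rewrite /L0; case: ifP => _; rewrite linearP.
pose L i : {linear (V * W)%type -> R^o} :=
  HB.pack (L0 i) (GRing.isLinear.Build _ _ _ _ _ (Llin i)).
exists (m + m')%N, (fun i => if (i < m)%N then (e i, 0) else (0, e' (i - m)%N)), L.
split.
  move=> i; change (continuous (L0 i)); rewrite /L0; case: (i < m)%N => h.
  - apply: (@continuous_comp _ _ _ fst (l i)); [exact: cvg_fst | exact: lc].
  - apply: (@continuous_comp _ _ _ snd (l' _)); [exact: cvg_snd | exact: lc'].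
move=> [h h']; rewrite big_split_ord /=.
have -> : \sum_(i < m) L (lshift m' i) (h, h') *:
  (if (lshift m' i < m)%N then (e (lshift m' i), 0)
   else (0, e' (lshift m' i - m)%N)) = (h, 0).
  have addl : {morph (fun x : V => (x, 0 : W)) : x y / x + y}.
    by move=> x y; congr pair; rewrite /= addr0.
  rewrite [in RHS](lE h) (big_morph _ addl (erefl _)).
  by apply: eq_bigr => i _; rewrite /= /L0 ltn_ord; congr pair; rewrite /= scaler0.
have -> : \sum_(i < m') L (rshift m i) (h, h') *:
  (if (rshift m i < m)%N then (e (rshift m i), 0)
   else (0, e' (rshift m i - m)%N)) = (0, h').
  have addr : {morph (fun x : W => (0 : V, x)) : x y / x + y}.
    by move=> x y; congr pair; rewrite /= addr0.
  rewrite [in RHS](lE' h') (big_morph _ addr (erefl _)).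
  apply: eq_bigr => i _ /=; rewrite /L0 ltnNge leq_addr /= addKn.
  by congr pair; rewrite /= scaler0.
by congr pair; rewrite /= ?addr0 ?add0r.
Qed.

Lemma near_eq_continuous (T T' : topologicalType) (F G : T -> T') z :
  (\near z, F z = G z) -> {for z, continuous F} -> {for z, continuous G}.
Proof.
move=> FG cF; have E := nbhs_singleton FG.
change (G @ z --> G z); rewrite -E; apply: cvg_trans cF.
exact: near_eq_cvg.
Qed.

Lemma Ck_on_ext V W k (U : set V) (F G : V -> W) : open U ->
  (forall z, U z -> F z = G z) -> Ck_on k U F -> Ck_on k U G.
Proof.
move=> oU; elim: k F G => [|k IH] F G FG [Fc F1];
  have nFG z (Uz : U z) : \near z, F z = G z
    by apply: filterS (open_nbhs_nbhs (conj oU Uz)).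
  by split=> // z Uz; apply: near_eq_continuous (Fc z Uz); exact: nFG.
split; first by move=> z Uz; apply: near_eq_continuous (Fc z Uz); exact: nFG.
move=> v; have [dF cF] := F1 v; split.
  by move=> z Uz; apply: near_eq_derivable (dF z Uz); exact: nFG.
apply: IH cF => z Uz; apply: near_eq_derive; exact: nFG.
Qed.

Lemma is_derive_linear_comp V W W' (l : {linear W -> W'}) (F : V -> W) z v :
  continuous l -> derivable F z v -> is_derive z v (l \o F) (l ('D_v F z)).
Proof.
move=> lc dF; have : (fun h => h^-1 *: ((l \o F \o shift z) (h *: v) - (l \o F) z)) @ 0^'
    --> l ('D_v F z).
  rewrite (_ : (fun _ => _) = l \o (fun h => h^-1 *: ((F \o shift z) (h *: v) - F z))).
    by apply: continuous_cvg dF; exact: lc.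
  by apply/funext => h /=; rewrite -linearB -linearZZ.
move=> H; apply: DeriveDef; first by apply/cvg_ex; exists (l ('D_v F z)).
exact: cvg_lim H.
Qed.

Lemma Ck_on_linear_comp V W W' k (U : set V) (l : {linear W -> W'}) (F : V -> W) :
  open U -> continuous l -> Ck_on k U F -> Ck_on k U (l \o F).
Proof.
move=> oU lc; elim: k F => [|k IH] F [Fc F1].
  by split=> // z Uz; apply: continuous_comp; [exact: Fc|exact: lc].
split; first by move=> z Uz; apply: continuous_comp; [exact: Fc|exact: lc].
move=> v; have [dF cF] := F1 v; split.
  by move=> z Uz; have [] := is_derive_linear_comp lc (dF z Uz).
apply: Ck_on_ext (IH _ cF) => // z Uz /=.
by have [_ ->] := is_derive_linear_comp lc (dF z Uz).
Qed.

Lemma C1_differentiable V W (F : V -> W) (U : set V) z :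
  findim V -> findim W -> open U -> Ck_on 1 U F -> U z -> differentiable F z.
Proof.
move=> fV [m [e [l [lc lE]]]] oU F1 Uz.
have -> : F = \sum_(i < m) (fun y => l i (F y) *: e i).
  by apply/funext => y; rewrite fct_sumE.
apply: differentiable_sum => i; apply: differentiableZl.
apply: (C1_differentiable_real fV oU) => //.
exact: (Ck_on_linear_comp oU (lc i) F1).
Qed.

(** Here [c] is derivable only in the direction [v]. Restricted to the line along [v] it becomes
    differentiable in one variable, and the chain rule for total differentials applies there. *)
Lemma chain_rule V V' W (F : V -> W) (c : V' -> V) z v dc :
  differentiable F (c z) -> is_derive z v c dc ->
  is_derive z v (F \o c) ('D_dc F (c z)).
Proof.
move=> dF [cz <-].
pose g (s : R) : V' := s *: v + z.
have gE h : g (h *: 1 + 0) = h *: v + g 0.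
  by rewrite /g scale0r add0r addr0 [_ *: 1]mulr1.
have g0 : g 0 = z by rewrite /g scale0r add0r.
have dcg : differentiable (c \o g) 0.
  by apply/derivable1_diffP; apply/(derive_affine c gE).2; rewrite g0.
have dF' : differentiable F ((c \o g) 0) by rewrite /= g0.
have dFcg : differentiable (F \o (c \o g)) 0 by exact: differentiable_comp.
apply: DeriveDef.
  rewrite -g0; apply/(derive_affine (F \o c) gE).2.
  exact: diff_derivable.
rewrite -[in LHS]g0 -(derive_affine (F \o c) gE).1 (deriveE _ dFcg).
rewrite diff_comp //= -(deriveE _ dcg) (derive_affine c gE).1 g0.
by rewrite -deriveE.
Qed.

Lemma is_derive_pair V W W' (f : V -> W) (g : V -> W') z v df dg :
  is_derive z v f df -> is_derive z v g dg ->
  is_derive z v (fun y => (f y, g y)) (df, dg).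
Proof.
move=> [fz <-] [gz <-].
have H : (fun h => h^-1 *: (((fun y => (f y, g y)) \o shift z) (h *: v) - (f z, g z)))
    @ 0^' --> ('D_v f z, 'D_v g z).
  exact: (@cvg_pair _ _ _ _ (nbhs ('D_v f z)) (nbhs ('D_v g z)) _ _ _
    (fun h => h^-1 *: ((f \o shift z) (h *: v) - f z))
    (fun h => h^-1 *: ((g \o shift z) (h *: v) - g z)) fz gz).
by apply: DeriveDef; [apply/cvg_ex; exists ('D_v f z, 'D_v g z)|exact: cvg_lim H].
Qed.

Lemma derive_dirP V W (F : V -> W) z a u v : differentiable F z ->
  'D_(a *: u + v) F z = a *: 'D_u F z + 'D_v F z.
Proof. by move=> dF; rewrite !deriveE // linearP. Qed.

(* The second difference of [F] along [u] and [v]; the expression on the left is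
   symmetric in [u] and [v], whence Schwarz's theorem. *)
Lemma second_difference V (F : V -> R^o) (z u v : V) (d : R) :
  (forall y, ball z d y -> derivable F y u) ->
  (forall y, ball z d y -> derivable ('D_u F) y v) ->
  `|u| + `|v| < d ->
  exists2 y, ball z d y &
    F (v + (u + z)) - F (u + z) - F (v + z) + F z = 'D_v ('D_u F) y.
Proof.
move=> dF ddF uvd.
have inball s s' : 0 <= s <= 1 -> 0 <= s' <= 1 -> ball z d (s' *: v + (s *: u + z)).
  move=> /andP[s0 s1] /andP[s0' s1']; rewrite -ball_normE /ball_ /= distrC addrA addrK.
  rewrite (le_lt_trans _ uvd) // addrC (le_trans (ler_normD _ _)) // !normrZ !ger0_norm //.
  by rewrite lerD // ler_piMl.
have I0 : 0 <= (0 : R) <= 1 by rewrite lexx ler01.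
have I1 : 0 <= (1 : R) <= 1 by rewrite lexx ler01.
pose G := (F \o (fun y => v + y)) - F : V -> R^o.
have trE y h : v + (h *: u + y) = h *: u + (v + y) by rewrite addrCA.
have dG (s : R) : 0 <= s <= 1 -> is_derive (s *: u + z) u G
    ('D_u F (v + (s *: u + z)) - 'D_u F (s *: u + z)).
  move=> s01; rewrite -(derive_affine F (trE (s *: u + z))).1.
  apply: is_deriveB; apply: derivableP.
    apply/(derive_affine F (trE _)).2; apply: dF.
    by have := inball s 1 s01 I1; rewrite scale1r.
  by apply: dF; have := inball s 0 s01 I0; rewrite scale0r add0r.
have [|s s01] := @mvt_line R V G z u.
  by move=> s s01; have [] := dG s s01.
have [_ ->] := dG s s01.
have [|s' s01' ->] := @mvt_line R V ('D_u F) (s *: u + z) v.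
  by move=> s' s01'; apply: ddF; exact: inball.
move=> E; exists (s' *: v + (s *: u + z)); first exact: inball.
by rewrite -E /G !fctE opprB [RHS]addrA [LHS]addrAC.
Qed.

Lemma dist_half_half (eps a b c : R) :
  `|a - c| <= eps / 2 -> `|b - c| <= eps / 2 -> `|a - b| <= eps.
Proof.
move=> ac bc; rewrite -(subrKA c) (splitr eps) (le_trans (ler_normD _ _)) //.
by rewrite lerD // distrC.
Qed.

(** On a small parallelogram with sides [r *: u] and [r *: v] the second difference is r^2 times
    either mixed derivative, each taken at its own point of a ball where both stay within [eps / 2]
    of their values at [z]. Cancelling r^2 identifies the two mixed derivatives at these points,
    hence up to [eps] at [z]. *)
Lemma schwarz_real V (F : V -> R^o) (U : set V) z (u v : V) :
  open U -> Ck_on 2 U F -> U z ->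
  'D_v ('D_u F) z = 'D_u ('D_v F) z.
Proof.
move=> oU [_ F2] Uz; apply/eqP; rewrite -subr_eq0 -normr_le0.
apply/ler_addgt0Pr => eps eps0; rewrite add0r.
have e2 : 0 < eps / 2 by rewrite divr_gt0.
have /cvgrPdist_le/(_ _ e2) cuv := (((F2 u).2.2 v).2).1 z Uz.
have /cvgrPdist_le/(_ _ e2) cvu := (((F2 v).2.2 u).2).1 z Uz.
have oUz := open_nbhs_nbhs (conj oU Uz).
have nH := @filterI _ (nbhs z) _ _ _ oUz (@filterI _ (nbhs z) _ _ _ cuv cvu).
have [d /= d0 dP] := (nbhs_ballP _ _).1 (nH _ _).
(* The summand 1 keeps the denominator positive when [u = v = 0] and makes the size of the
   parallelogram strictly smaller than [d]. *)
pose r : R := d / (`|u| + `|v| + 1).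
have n0 : 0 < `|u| + `|v| + 1 by rewrite ltr_pwDr // addr_ge0.
have r0 : 0 < r by rewrite divr_gt0.
have small : `|r *: u| + `|r *: v| < d.
  rewrite (normrZ r u) (normrZ r v) -mulrDr gtr0_norm // /r mulrAC ltr_pdivrMr //.
  by rewrite ltr_pM2l // ltrDl.
have D1 w y : ball z d y -> is_derive y (r *: w) F (r *: 'D_w F y).
  by move=> /dP[Uy _]; apply: is_derive_dirZ; exact: (F2 w).1.
have D2 w w' y : ball z d y ->
    is_derive y (r *: w') ('D_(r *: w) F) (r *: (r *: 'D_w' ('D_w F) y)).
  move=> By; have Uy := (dP _ By).1.
  have H : is_derive y (r *: w') (r *: 'D_w F) (r *: (r *: 'D_w' ('D_w F) y)).
    apply: is_deriveZ; apply: is_derive_dirZ; exact: ((F2 w).2.2 w').1.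
  apply: near_eq_is_derive H.
  have /nbhs_ballP[d' /= d'0 d'P] := open_nbhs_nbhs (conj oU Uy).
  apply/nbhs_ballP; exists d' => // x /d'P Ux.
  by have [_ ->] := is_derive_dirZ r ((F2 w).1 x Ux).
have [||//|y By Ey] := @second_difference V F z (r *: u) (r *: v) d.
- by move=> y By; have [] := D1 u y By.
- by move=> y By; have [] := D2 u v y By.
have [||//|y' By' Ey'] := @second_difference V F z (r *: v) (r *: u) d.
- by move=> y' By'; have [] := D1 v y' By'.
- by move=> y' By'; have [] := D2 v u y' By'.
- by rewrite addrC.
have E : r *: (r *: 'D_v ('D_u F) y) = r *: (r *: 'D_u ('D_v F) y').
  case: (D2 u v y By) => _ E1; case: (D2 v u y' By') => _ E2.
  apply: (etrans (esym E1)); apply: (etrans _ E2).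
  apply: (etrans (esym Ey)); apply: (etrans _ Ey').
  by rewrite (addrCA (r *: u)); congr (_ + _); rewrite addrAC.
have {}E : 'D_v ('D_u F) y = 'D_u ('D_v F) y'.
  exact: (scalerI (lt0r_neq0 r0) (scalerI (lt0r_neq0 r0) E)).
have [_ [H1 _]] := dP _ By; have [_ [_ H2]] := dP _ By'.
move: H1; rewrite E => H1; exact: dist_half_half H1 H2.
Qed.

Lemma schwarz V W (F : V -> W) (U : set V) z (u v : V) : findim W ->
  open U -> Ck_on 2 U F -> U z ->
  'D_v ('D_u F) z = 'D_u ('D_v F) z.
Proof.
move=> [m [e [l [lc lE]]]] oU F2 Uz.
have H a b i : l i ('D_b ('D_a F) z) = 'D_b ('D_a (l i \o F)) z.
  have [_ <-] := is_derive_linear_comp (lc i) (((F2.2 a).2.2 b).1 z Uz).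
  apply: near_eq_derive; apply: filterS (open_nbhs_nbhs (conj oU Uz)) => y Uy /=.
  by have [_ ->] := is_derive_linear_comp (lc i) ((F2.2 a).1 y Uy).
apply: (etrans (lE _)); apply: (etrans _ (esym (lE _))).
apply: eq_bigr => i _; apply: (f_equal (fun r => r *: e i)).
apply: (etrans (H u v i)); apply: (etrans _ (esym (H v u i))).
exact: (schwarz_real _ _ oU (Ck_on_linear_comp oU (lc i) F2) Uz).
Qed.

End ChainRuleAndSchwarz.

(** * Stability of C^k maps under sums, products, composition and pairing *)

Section CkClosure.
Context {R : realType}.
Implicit Types V W : normedModType R.

Lemma Ck_onW V W k (U : set V) (F : V -> W) : Ck_on k.+1 U F -> Ck_on k U F.
Proof.
elim: k F => [|k IH] F [Fc F1]; first by split.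
by split=> // v; have [dF cF] := F1 v; split=> //; exact: IH.
Qed.

Lemma Ck_on_le V W k k' (U : set V) (F : V -> W) : (k <= k')%N ->
  Ck_on k' U F -> Ck_on k U F.
Proof.
elim: k' => [|k' IH]; first by rewrite leqn0 => /eqP ->.
by rewrite leq_eqVlt => /predU1P[->//|/IH] H /Ck_onW.
Qed.

Lemma Ck_on_sub V W k (U U' : set V) (F : V -> W) : U' `<=` U ->
  Ck_on k U F -> Ck_on k U' F.
Proof.
move=> UU'; elim: k F => [|k IH] F [Fc F1].
  by split=> // z /UU'; exact: Fc.
split=> [z /UU'|v]; first exact: Fc.
have [dF cF] := F1 v; split=> [z /UU'|]; first exact: dF.
exact: IH.
Qed.

Lemma Ck_on_cst V W k (U : set V) (a : W) : Ck_on k U (fun=> a : W).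
Proof.
elim: k a => [|k IH] a; split=> //; try by move=> z _; exact: cst_continuous.
move=> v; split; first by move=> z _; exact: derivable_cst.
have -> : (fun z => 'D_v (fun=> a) z) = (fun=> 0 : W).
  by apply/funext => z; exact: derive_cst.
exact: IH.
Qed.

Lemma Ck_on_add V W k (U : set V) (F G : V -> W) : open U ->
  Ck_on k U F -> Ck_on k U G -> Ck_on k U (F + G).
Proof.
move=> oU; elim: k F G => [|k IH] F G [Fc F1] [Gc G1].
  by split=> // z Uz; apply: continuousD; [exact: Fc|exact: Gc].
split=> [z Uz|v]; first by apply: continuousD; [exact: Fc|exact: Gc].
have [dF cF] := F1 v; have [dG cG] := G1 v; split.
  by move=> z Uz; apply: derivableD; [exact: dF|exact: dG].
apply: Ck_on_ext (IH _ _ cF cG) => // z Uz.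
by rewrite deriveD //; [exact: dF|exact: dG].
Qed.

Lemma is_derive_scale V W (a : V -> R^o) (F : V -> W) z v :
  derivable a z v -> derivable F z v -> {for z, continuous a} ->
  is_derive z v (fun y => a y *: F y) (a z *: 'D_v F z + 'D_v a z *: F z).
Proof.
move=> da dF ca.
(* The increment is split as a(z) (F(y) - F(z)) + (a(y) - a(z)) F(y). The second term needs F to
   converge along the line, which derivability in the direction [v] provides. *)
have Fline : (fun h : R => F (h *: v + z)) @ 0^' --> F z.
  have dFl : derivable (fun h : R => F (h *: v + z)) 0 1 by exact: (derivable1P F z v).1.
  have H : (fun h : R => F (h *: v + z)) @ 0 --> F (0 *: v + z).
    exact: differentiable_continuous ((derivable1_diffP _ _).1 dFl).
  rewrite scale0r add0r in H.
  by apply: cvg_trans H; apply: cvg_app; exact: cvg_within.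
have H : (fun h => h^-1 *: (((fun y => a y *: F y) \o shift z) (h *: v) - a z *: F z))
    @ 0^' --> a z *: 'D_v F z + 'D_v a z *: F z.
  rewrite (_ : (fun _ => _) = (fun h => a z *: (h^-1 *: ((F \o shift z) (h *: v) - F z)) +
     (h^-1 *: ((a \o shift z) (h *: v) - a z)) *: F (h *: v + z))).
    apply: cvgD; first by apply: cvgZr; exact: dF.
    by apply: cvgZ; [exact: da|exact: Fline].
  have alg (r A b : R) (P Q : W) : r *: (A *: P - b *: Q) =
      b *: (r *: (P - Q)) + (r * (A - b)) *: P.
    rewrite scalerA [b * r]mulrC -!scalerA -scalerDr; congr (_ *: _).
    by rewrite scalerBr scalerBl [RHS]addrC [RHS]addrA subrK.
  by apply/funext => h; exact: alg.
by apply: DeriveDef; [apply/cvg_ex; eexists; exact: H|exact: cvg_lim H].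
Qed.

Lemma Ck_on_scale V W k (U : set V) (a : V -> R^o) (F : V -> W) : open U ->
  Ck_on k U a -> Ck_on k U F -> Ck_on k U (fun z => a z *: F z).
Proof.
move=> oU; elim: k a F => [|k IH] a F [ac a1] [Fc F1].
  by split=> // z Uz; apply: continuousZ; [exact: ac|exact: Fc].
split=> [z Uz|v]; first by apply: continuousZ; [exact: ac|exact: Fc].
have [da ca] := a1 v; have [dF cF] := F1 v.
have D z : U z -> is_derive z v (fun y => a y *: F y)
    (a z *: 'D_v F z + 'D_v a z *: F z).
  by move=> Uz; apply: is_derive_scale; [exact: da|exact: dF|exact: ac].
split; first by move=> z /D[].
have ak : Ck_on k U a by apply: Ck_onW; split.
have Fk : Ck_on k U F by apply: Ck_onW; split.
apply: Ck_on_ext (Ck_on_add oU (IH _ _ ak cF) (IH _ _ ca Fk)) => // z /D[_ ->] //.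
Qed.

Lemma Ck_on_sum V W k (U : set V) m (F : 'I_m -> V -> W) : open U ->
  (forall i, Ck_on k U (F i)) -> Ck_on k U (fun z => \sum_(i < m) F i z).
Proof.
move=> oU; elim: m F => [|m IH] F Fk.
  rewrite (_ : (fun _ => _) = fun=> 0); first exact: Ck_on_cst.
  by apply/funext => z; rewrite big_ord0.
rewrite (_ : (fun _ => _) = (fun z => \sum_(i < m) F (widen_ord (leqnSn m) i) z) + F ord_max).
  by apply: Ck_on_add => //; exact: IH.
by apply/funext => z; rewrite big_ord_recr.
Qed.

(** The chain rule yields a derivative of [F] in the moving direction 'D_v c z. Expanding that
    direction in coordinates turns it into a finite sum of scalar functions times fixed partial
    derivatives of [F] composed with [c], to which the induction hypothesis applies. *)
Lemma Ck_on_comp V V' W k (U : set V) (U' : set V') (F : V -> W) (c : V' -> V) :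
  findim V -> findim W -> open U -> open U' -> (forall z, U' z -> U (c z)) ->
  Ck_on k U F -> Ck_on k U' c -> Ck_on k U' (F \o c).
Proof.
move=> fV fW oU oU' U'U; elim: k F => [|k IH] F Fk ck.
  split=> // z Uz; apply: continuous_comp; first exact: ck.1.
  by apply: Fk.1; exact: U'U.
split=> [z Uz|v].
  apply: continuous_comp; first exact: ck.1.
  by apply: Fk.1; exact: U'U.
have F1 : Ck_on 1 U F.
  exact: Ck_on_le Fk.
have D z : U' z -> is_derive z v (F \o c) ('D_('D_v c z) F (c z)).
  move=> Uz; apply: chain_rule; last exact/derivableP/(ck.2 v).1.
  by apply: (C1_differentiable fV fW oU F1); exact: U'U.
split; first by move=> z /D[].
have [m [e [l [lc lE]]]] := fV.
have H : Ck_on k U' (fun z => \sum_(i < m) (l i ('D_v c z) : R^o) *: 'D_(e i) F (c z)).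
  apply: Ck_on_sum => // i; apply: Ck_on_scale => //.
    exact: (Ck_on_linear_comp oU' (lc i) (ck.2 v).2).
  by apply: (IH ('D_(e i) F)); [exact: (Fk.2 (e i)).2|exact: Ck_onW].
apply: Ck_on_ext H => // z Uz; have [_ ->] := D z Uz.
have dF : differentiable F (c z) by apply: (C1_differentiable fV fW oU F1); exact: U'U.
rewrite [in RHS](lE ('D_v c z)) [RHS]deriveE // linear_sum; apply: eq_bigr => i _.
by rewrite [RHS]linearZZ (deriveE _ dF).
Qed.

Lemma Ck_on_pair V W W' k (U : set V) (F : V -> W) (G : V -> W') : open U ->
  Ck_on k U F -> Ck_on k U G -> Ck_on k U (fun z => (F z, G z)).
Proof.
move=> oU; elim: k F G => [|k IH] F G [Fc F1] [Gc G1].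
  by split=> // z Uz; apply: cvg_pair; [exact: Fc|exact: Gc].
split=> [z Uz|v]; first by apply: cvg_pair; [exact: Fc|exact: Gc].
have [dF cF] := F1 v; have [dG cG] := G1 v.
have D z : U z -> is_derive z v (fun z => (F z, G z)) ('D_v F z, 'D_v G z).
  by move=> Uz; apply: is_derive_pair; apply: derivableP; [exact: dF|exact: dG].
split; first by move=> z /D[].
by apply: Ck_on_ext (IH _ _ cF cG) => // z /D[_ ->].
Qed.

Lemma Ck_on_id V k (U : set V) : Ck_on k U (id : V -> V).
Proof.
case: k => [|k]; first by split=> // z _; exact: cvg_id.
split=> [z _|v]; first exact: cvg_id.
split; first by move=> z _; exact: derivable_id.
have -> : (fun z => 'D_v id z) = (fun=> v).
  by apply/funext => z; exact: derive_id.
exact: Ck_on_cst.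
Qed.

Lemma Ck_on_derive V W k (U : set V) (F : V -> W) v :
  Ck_on k.+1 U F -> Ck_on k U ('D_v F).
Proof. by move=> [_ /(_ v)[]]. Qed.

End CkClosure.

(** * Charts *)

Section ManifoldLemmas.
Context {R : realType}.
Implicit Types E F : normedModType R.

Section OneChart.
Context {E : normedModType R} {M : topologicalType}.
Implicit Types (c : chart E M) (W : set M).

Lemma inv_coord c p : is_chart c -> dom c p -> inv c (coord c p) = p.
Proof. by move=> [_ _ H _ _]; exact: H. Qed.

Lemma chart_near c W p : is_chart c -> dom c p -> nbhs p W ->
  \forall z \near coord c p, [/\ dom c (inv c z), W (inv c z) &
                                 coord c (inv c z) = z].
Proof.
move=> [od oi cK cc ci] dp Wp.
have ip : (coord c @` dom c) (coord c p) by exists p.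
have n1 : \forall z \near coord c p, (coord c @` dom c) z.
  exact: open_nbhs_nbhs.
have n2 : \forall z \near coord c p, W (inv c z).
  have ciz : inv c z @[z --> coord c p] --> inv c (coord c p) := ci _ ip.
  by move: ciz; rewrite cK //; apply.
(* On the image of the domain, the left inverse given by [is_chart] is also a right inverse. *)
apply: filterS2 n1 n2 => z [q dq <-]; by rewrite cK.
Qed.

Lemma chart_near_coord c p (P : set E) : is_chart c -> dom c p ->
  (\forall z \near coord c p, P z) -> \forall q \near p, P (coord c q).
Proof. by move=> [_ _ _ cc _] dp; exact: cc. Qed.

Lemma open_coord_image c W : is_chart c -> open W -> W `<=` dom c ->
  open (coord c @` W).
Proof.
move=> cM oW Wd; rewrite openE => z [p Wp <-].
apply: filterS (chart_near cM (Wd _ Wp) (open_nbhs_nbhs (conj oW Wp))).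
by move=> z' [dz Wz <-]; exists (inv c z').
Qed.

Lemma chart_nbhs c p : is_chart c -> dom c p -> nbhs p (dom c).
Proof. by move=> [od _ _ _ _] dp; exact: open_nbhs_nbhs. Qed.

End OneChart.

Lemma open_preimage (T T' : topologicalType) (U : set T) (V : set T') (f : T -> T') :
  open U -> (forall p, U p -> {for p, continuous f}) -> open V ->
  open (U `&` f @^-1` V).
Proof.
move=> oU cf oV; rewrite openE => p [Up Vp]; apply: filterI.
  exact: open_nbhs_nbhs.
by apply: (cf p Up); exact: open_nbhs_nbhs.
Qed.

Lemma open_setX (T T' : topologicalType) (U : set T) (V : set T') :
  open U -> open V -> open (U `*` V).
Proof.
move=> oU oV; rewrite openE => -[p q] [/= Up Vq]; exists (U, V) => //=.
by split; exact: open_nbhs_nbhs.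
Qed.

Lemma is_chart_line (c : chart R^o R) : atlas (@line R) c -> is_chart c.
Proof.
move=> ->; split => //=; first exact: openT.
- by rewrite image_id; exact: openT.
- by move=> p _; exact: cvg_id.
- by move=> p _; exact: cvg_id.
Qed.

Lemma is_chart_prod E F (M N : topologicalType) (c : chart E M) (d : chart F N) :
  is_chart c -> is_chart d -> is_chart (prod_chart c d).
Proof.
move=> [oc ic cK cc ci] [od id' dK cd di].
have imE : coord (prod_chart c d) @` dom (prod_chart c d) =
    (coord c @` dom c) `*` (coord d @` dom d).
  apply/seteqP; split => [_ [[p q] [/= dp dq] <-]|[z w] [[p dp /= <-] [q dq /= <-]]].
    by split => /=; [exists p|exists q].
  by exists (p, q).
split.
- exact: open_setX.
- by rewrite imE; exact: open_setX.
- by move=> [p q] [/= dp dq]; rewrite cK // dK.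
- move=> [p q] [/= dp dq]; apply: (@cvg_pair _ _ _ _ (nbhs (coord c p)) (nbhs (coord d q))).
    exact: (@cvg_comp _ _ _ fst (coord c) _ _ _ cvg_fst (cc p dp)).
  exact: (@cvg_comp _ _ _ snd (coord d) _ _ _ cvg_snd (cd q dq)).
- rewrite imE => -[z w] [/= dz dw]; apply: (@cvg_pair _ _ _ _ (nbhs (inv c z)) (nbhs (inv d w))).
    exact: (@cvg_comp _ _ _ fst (inv c) _ _ _ cvg_fst (ci z dz)).
  exact: (@cvg_comp _ _ _ snd (inv d) _ _ _ cvg_snd (di w dw)).
Qed.

Section ChangeOfChart.
Context {E : normedModType R} {M : topologicalType} (A : smooth_structure E M).
Hypotheses (fE : findim E) (HA : is_smooth_manifold A).

Lemma atlas_chart c : atlas A c -> is_chart c.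
Proof. by case: HA => _ _ H _ _; exact: H. Qed.

Lemma chart_at_atlas p : atlas A (chart_at A p).
Proof. by case: HA => _ _ _ _ /(_ p)[]. Qed.

Lemma chart_at_dom p : dom (chart_at A p) p.
Proof. by case: HA => _ _ _ _ /(_ p)[]. Qed.

Lemma open_overlap c d : atlas A c -> atlas A d ->
  open (coord c @` (dom c `&` dom d)).
Proof.
move=> Ac Ad; apply: open_coord_image; first exact: atlas_chart.
  by apply: openI; [have [] := atlas_chart Ac|have [] := atlas_chart Ad].
by move=> p [].
Qed.

Lemma transition_differentiable c d p : atlas A c -> atlas A d ->
  dom c p -> dom d p -> differentiable (coord d \o inv c) (coord c p).
Proof.
move=> Ac Ad dc dd.
have [_ _ _ /(_ c d Ac Ad)/(_ 1%N) cdk _] := HA.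
apply: (C1_differentiable fE fE (open_overlap Ac Ad) cdk).
by exists p.
Qed.

Lemma is_derive_coord_inv c p w : atlas A c -> dom c p ->
  is_derive (coord c p) w (coord c \o inv c) w.
Proof.
move=> Ac dp; apply: near_eq_is_derive (is_derive_id (coord c p) w).
by apply: filterS (chart_near (atlas_chart Ac) dp (filterT : nbhs p setT)) => z [].
Qed.

Lemma transition_near c d p : atlas A c -> atlas A d -> dom c p -> dom d p ->
  \forall z \near coord c p, inv d ((coord d \o inv c) z) = inv c z.
Proof.
move=> Ac Ad dc dd.
apply: filterS (chart_near (atlas_chart Ac) dc (chart_nbhs (atlas_chart Ad) dd)).
by move=> z [_ dz _]; rewrite /= inv_coord //; exact: atlas_chart.
Qed.

(** The two transition maps compose to the identity near [coord c p], so by the chain rule their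
    derivatives are mutually inverse. *)
Lemma transition_derive_cancel c d p w : atlas A c -> atlas A d ->
  dom c p -> dom d p ->
  'D_('D_w (coord d \o inv c) (coord c p)) (coord c \o inv d) (coord d p) = w.
Proof.
move=> Ac Ad dc dd.
have D := @chain_rule R E E E (coord c \o inv d) (coord d \o inv c) (coord c p) w
  ('D_w (coord d \o inv c) (coord c p)).
have E1 : (coord d \o inv c) (coord c p) = coord d p.
  by rewrite /= inv_coord //; exact: atlas_chart.
rewrite E1 in D.
have [||_ <-] := D.
- exact: transition_differentiable.
- by apply: derivableP; apply: diff_derivable; exact: transition_differentiable.
have [_ H] := is_derive_coord_inv w Ac dc.
rewrite -[RHS]H; apply: near_eq_derive.
by apply: filterS (transition_near Ac Ad dc dd) => z /= ->.
Qed.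

Lemma tvecK c p w : atlas A c -> dom c p -> comps A c p (tvec A c p w) = w.
Proof.
move=> Ac dp; apply: transition_derive_cancel => //.
  exact: chart_at_atlas.
exact: chart_at_dom.
Qed.

Lemma compsK c p u : atlas A c -> dom c p -> tvec A c p (comps A c p u) = u.
Proof.
move=> Ac dp; apply: transition_derive_cancel => //.
  exact: chart_at_atlas.
exact: chart_at_dom.
Qed.

Lemma tvec_linear c p a u v : atlas A c -> dom c p ->
  tvec A c p (a *: u + v) = a *: tvec A c p u + tvec A c p v.
Proof.
move=> Ac dp; apply: derive_dirP; apply: transition_differentiable => //.
  exact: chart_at_atlas.
exact: chart_at_dom.
Qed.

Lemma tvec_chart_at p w : tvec A (chart_at A p) p w = w.
Proof.
by have [_] := is_derive_coord_inv w (chart_at_atlas p) (chart_at_dom p).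
Qed.

(** Chart independence of the differential: in the preferred chart, [g] is [G] composed with a
    transition map. [G] need agree with [g \o inv c] only near the point, so an expression already
    known to be differentiable can be supplied. *)
Lemma vdiff_tvec F (g : M -> F) (G : E -> F) c p w : atlas A c -> dom c p ->
  (\forall z \near coord c p, g (inv c z) = G z) -> differentiable G (coord c p) ->
  vdiff A g p (tvec A c p w) = 'D_w G (coord c p).
Proof.
move=> Ac dp gG dG.
pose c0 := chart_at A p; have Ac0 : atlas A c0 := chart_at_atlas p.
have d0 : dom c0 p := chart_at_dom p.
have E1 : (coord c \o inv c0) (coord c0 p) = coord c p.
  by rewrite /= inv_coord //; exact: atlas_chart.
have dG' : differentiable G ((coord c \o inv c0) (coord c0 p)) by rewrite E1.
have D : is_derive (coord c0 p) (tvec A c p w) (coord c \o inv c0) w.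
  rewrite -[X in is_derive _ _ _ X](tvecK w Ac dp); apply: derivableP.
  by apply: diff_derivable; exact: transition_differentiable.
have [_ DG] := chain_rule dG' D; rewrite E1 in DG; rewrite -DG.
apply: near_eq_derive.
have cM0 := atlas_chart Ac0; have cM := atlas_chart Ac.
have n1 := chart_near cM0 d0 (chart_nbhs cM dp).
have n2 : \forall q \near p, g (inv c (coord c q)) = G (coord c q).
  exact: (chart_near_coord cM dp gG).
have n3 := chart_near cM0 d0 n2.
apply: filterS2 n1 n3 => z [dz dcz zK] [_ gz _].
by rewrite /= -gz inv_coord.
Qed.

End ChangeOfChart.

Section MapsBetween.
Context {E F : normedModType R} {M N : topologicalType}.
Context (A : smooth_structure E M) (B : smooth_structure F N).
Hypotheses (fE : findim E) (fF : findim F).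
Hypotheses (HA : is_smooth_manifold A) (HB : is_smooth_manifold B).

Lemma open_smooth_domain (U : set M) (f : M -> N) (c : chart E M) (d : chart F N) :
  open U ->
  (forall p, U p -> {for p, continuous f}) -> is_chart c -> is_chart d ->
  open (coord c @` (dom c `&` U `&` f @^-1` dom d)).
Proof.
move=> oU cf cM dN; apply: open_coord_image => //; last by move=> p [[]].
rewrite -setIA; apply: openI; first by case: cM.
by apply: open_preimage => //; case: dN.
Qed.

Variable f : M -> N.
Hypothesis sf : smooth_on A B setT f.

Lemma smooth_chart_nbhs c d p : atlas A c -> atlas B d -> dom c p -> dom d (f p) ->
  exists2 U : set E, open U /\ U (coord c p) &
    (forall k, Ck_on k U (coord d \o f \o inv c)) /\
    (forall z, U z -> [/\ dom c (inv c z), dom d (f (inv c z)) &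
                          coord c (inv c z) = z]).
Proof.
move=> Ac Bd dp dfp.
have cM := atlas_chart HA Ac; have dN := atlas_chart HB Bd.
exists (coord c @` (dom c `&` setT `&` f @^-1` dom d)).
  split; last by exists p.
  by apply: open_smooth_domain => //; [exact: openT|exact: sf.1].
split; first by move=> k; exact: sf.2.
by move=> z [q [[dq _] dfq] <-]; rewrite inv_coord.
Qed.

Lemma smooth_chart_differentiable c d p : atlas A c -> atlas B d ->
  dom c p -> dom d (f p) -> differentiable (coord d \o f \o inv c) (coord c p).
Proof.
move=> Ac Bd dp dfp.
have [U [oU Uz] [fk _]] := smooth_chart_nbhs Ac Bd dp dfp.
exact: (C1_differentiable fE fF oU (fk 1%N)).
Qed.

Lemma mdiff_tvec c p w : atlas A c -> dom c p ->
  mdiff A B f p (tvec A c p w) =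
  'D_w (coord (chart_at B (f p)) \o f \o inv c) (coord c p).
Proof.
move=> Ac dp; apply: vdiff_tvec => //.
  exact: nearW.
apply: smooth_chart_differentiable => //; first exact: chart_at_atlas.
exact: chart_at_dom.
Qed.

Lemma comps_mdiff_tvec c d p w : atlas A c -> atlas B d -> dom c p -> dom d (f p) ->
  comps B d (f p) (mdiff A B f p (tvec A c p w)) =
  'D_w (coord d \o f \o inv c) (coord c p).
Proof.
move=> Ac Bd dp dfp; rewrite mdiff_tvec //.
pose d0 := chart_at B (f p); have Bd0 : atlas B d0 := chart_at_atlas HB (f p).
have dd0 : dom d0 (f p) := chart_at_dom HB (f p).
have cM := atlas_chart HA Ac.
have E1 : (coord d0 \o f \o inv c) (coord c p) = coord d0 (f p).
  by rewrite /= inv_coord.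
have dtr : differentiable (coord d \o inv d0) ((coord d0 \o f \o inv c) (coord c p)).
  by rewrite E1; exact: (transition_differentiable fF HB Bd0 Bd).
have D := chain_rule dtr (derivableP (diff_derivable (v := w)
  (smooth_chart_differentiable Ac Bd0 dp dd0))).
have [_ Dv] := D; rewrite E1 in Dv; apply: (etrans (esym Dv)).
apply: near_eq_derive.
have n : nbhs p (f @^-1` dom d0).
  by apply: (sf.1 p I); exact: (chart_nbhs (atlas_chart HB Bd0)).
apply: filterS (chart_near cM dp n) => z [_ dfz _] /=.
by rewrite inv_coord //; exact: (atlas_chart HB Bd0).
Qed.

End MapsBetween.
End ManifoldLemmas.

(** * The second fundamental form in charts *)

Section SecondFundamentalForm.
Context {R : realType} {E F : normedModType R} {M N : topologicalType}.
Context (A : smooth_structure E M) (B : smooth_structure F N).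
Hypotheses (fE : findim E) (fF : findim F).
Hypotheses (HA : is_smooth_manifold A) (HB : is_smooth_manifold B).

Section Tensor.
Variable g : N -> F -> F -> R.
Hypothesis gbil : forall q, bilinear_form (g q).
Hypothesis gsym : forall q u v, g q u v = g q v u.

Lemma form_linl q r a b c : g q (r *: a + b) c = r * g q a c + g q b c.
Proof. exact: (gbil q).2. Qed.

Lemma form_addl q a b c : g q (a + b) c = g q a c + g q b c.
Proof. by rewrite -[a]scale1r form_linl scale1r mul1r. Qed.

Lemma form_scalel q r a c : g q (r *: a) c = r * g q a c.
Proof.
have g0 : g q 0 c = 0 by apply: (addrI (g q 0 c)); rewrite -form_addl !addr0.
by rewrite -[r *: a]addr0 form_linl g0 addr0.
Qed.

Lemma tensor_in_coord d q u v : atlas B d -> dom d q ->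
  tensor_in B g d (coord d q) u v = g q (tvec B d q u) (tvec B d q v).
Proof. by move=> Bd dq; rewrite /tensor_in inv_coord //; exact: atlas_chart Bd. Qed.

Lemma tensor_sym d z u v : tensor_in B g d z u v = tensor_in B g d z v u.
Proof. exact: gsym. Qed.

Lemma tensor_linear d z a u v w : atlas B d -> (coord d @` dom d) z ->
  tensor_in B g d z (a *: u + v) w = a * tensor_in B g d z u w + tensor_in B g d z v w.
Proof.
move=> Bd [q dq <-]; rewrite !tensor_in_coord // tvec_linear //.
by rewrite form_addl form_scalel.
Qed.

(* Koszul's formula for the combination of Christoffel symbols that enters the
   second fundamental form; no inverse metric is involved. *)
Lemma koszul G d z a b : is_levi_civita B g G -> atlas B d ->
  (coord d @` dom d) z ->
  tensor_in B g d z (G d z a a) b =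
  'D_a (fun y => tensor_in B g d y a b : R^o) z -
  2^-1 * 'D_b (fun y => tensor_in B g d y a a : R^o) z.
Proof.
move=> LC Bd zd; have [_ Gsym GD] := LC d z Bd zd.
rewrite (GD a b a) (GD a a b) (tensor_sym d z (G d z b a)) (Gsym b a).
by field.
Qed.

End Tensor.

Variables (g : N -> F -> F -> R) (GN : chart F N -> F -> F -> F -> F).
Variables (GM : chart E M -> E -> E -> E -> E).
Hypothesis gbil : forall q, bilinear_form (g q).
Hypothesis gsym : forall q u v, g q u v = g q v u.
Hypothesis LC : is_levi_civita B g GN.
Variables (f : M -> N) (nu : M -> F) (sigma : R) (h : M -> E -> E -> R).
Hypothesis sf : smooth_on A B setT f.
Hypothesis sigma2 : sigma * sigma = 1.
Hypothesis nuunit : forall p, g (f p) (nu p) (nu p) = sigma.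
Hypothesis nunormal : forall p u, g (f p) (nu p) (mdiff A B f p u) = 0.
Hypothesis Hh : is_second_fundamental_form A B GM GN f nu sigma h.

(** Fields with constant components in [c] are the test fields for the Gauss formula. In another
    chart their components are the derivative along [w] of the transition map. *)
Lemma smooth_field_tvec c w : atlas A c ->
  smooth_field_on A A (dom c) id (fun q => tvec A c q w).
Proof.
move=> Ac c' d' Ac' Ad' k.
have cM := atlas_chart HA Ac; have cM' := atlas_chart HA Ac'.
have dM' := atlas_chart HA Ad'.
have [_ _ _ compat _] := HA.
set W := _ @` _.
have oW : open W.
  apply: open_smooth_domain => //; first by case: cM.
  by move=> p _; exact: cvg_id.
have dE : open (coord c @` (dom c `&` dom d')) by exact: (open_overlap HA Ac Ad').
have H : Ck_on k W ((fun y => 'D_w (coord d' \o inv c) y) \o (coord c \o inv c')).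
  apply: (@Ck_on_comp R E E E k (coord c @` (dom c `&` dom d'))) => //.
  - move=> z [p [[dp dcp] dd'p] <-].
    by exists p => //; rewrite /= inv_coord.
  - exact: (Ck_on_derive _ (compat c d' Ac Ad' k.+1)).
  - apply: Ck_on_sub (compat c' c Ac' Ac k) => z [p [[dp dcp] dd'p] <-].
    by exists p.
apply: Ck_on_ext H => // z [p [[dp dcp] dd'p] <-] /=; rewrite inv_coord //.
rewrite /comps (vdiff_tvec fE HA (G := coord d' \o inv c)) //.
  exact: nearW.
exact: (transition_differentiable fE HA).
Qed.

Definition sff_in (c : chart E M) (d : chart F N) (z w1 w2 : E) (b : F) : R :=
  let X := coord d \o f \o inv c in
  - (tensor_in B g d (X z) ('D_w1 ('D_w2 X) z) b +
     tensor_in B g d (X z) (GN d (X z) ('D_w1 X z) ('D_w2 X z)) b).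

(** Pairing the Gauss formula with [nu] kills the tangential part and leaves - sigma h g(nu, nu) = -
    sigma^2 h = - h, so the sign is the same for both values of sigma. *)
Lemma sff_tvec c d p w1 w2 : atlas A c -> atlas B d -> dom c p -> dom d (f p) ->
  h p (tvec A c p w1) (tvec A c p w2) =
  sff_in c d (coord c p) w1 w2 (comps B d (f p) (nu p)).
Proof.
move=> Ac Bd dp dfp.
have cM := atlas_chart HA Ac; have dN := atlas_chart HB Bd.
pose X := coord d \o f \o inv c.
have Xp : X (coord c p) = coord d (f p) by rewrite /X /= inv_coord.
have od : open (dom c) by case: cM.
have := Hh (tvec A c p w1) od dp (smooth_field_tvec w2 Ac) Ac dp Bd dfp.
set cN := covariant _ _ _ _ _ _ _ _; set cM' := covariant _ _ _ _ _ _ _ _.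
move=> cE.
have gN : g (f p) cN (nu p) = - h p (tvec A c p w1) (tvec A c p w2).
  rewrite cE -scaleNr form_addl // form_scalel // nuunit.
  rewrite (gsym _ (mdiff _ _ _ _ _)) nunormal add0r mulNr mulrAC sigma2 mul1r.
  by [].
have [U [oU Uz] [Xk UP]] := smooth_chart_nbhs HA HB sf Ac Bd dp dfp.
(* Near [p] the components of the pushed-forward field form the function 'D_w2 X, so differentiating
   them along [w1] gives a second derivative of [X]. *)
have E1 : vdiff A (fun q => comps B d (f q) (mdiff A B f q (tvec A c q w2))) p
    (tvec A c p w1) = 'D_w1 ('D_w2 X) (coord c p).
  apply: vdiff_tvec => //.
    apply: filterS (open_nbhs_nbhs (conj oU Uz)) => z /UP[dz dfz zK].
    by rewrite comps_mdiff_tvec // zK.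
  apply: (C1_differentiable fE fF oU (U := U)) => //.
  exact: (Ck_on_derive _ (Xk 2%N)).
apply: oppr_inj; rewrite -gN /cN /covariant E1 !comps_mdiff_tvec //.
rewrite /sff_in -/X Xp !(tensor_in_coord g _ _ Bd dfp) -form_addl // opprK.
rewrite (compsK fF HB _ Bd dfp).
apply: (f_equal (fun a => g (f p) a (nu p))).
by rewrite -[X in tvec _ _ _ (X + _)]scale1r tvec_linear // scale1r.
Qed.

Lemma sff_chart_at p u v (c := chart_at A p) (d := chart_at B (f p)) :
  h p u v = sff_in c d (coord c p) u v (comps B d (f p) (nu p)).
Proof.
rewrite -sff_tvec ?tvec_chart_at //;
  by [exact: chart_at_atlas | exact: chart_at_dom].
Qed.

Lemma sff_sym p u v : h p u v = h p v u.
Proof.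
pose c := chart_at A p; have Ac : atlas A c := chart_at_atlas HA p.
have dp : dom c p := chart_at_dom HA p.
pose d := chart_at B (f p); have Bd : atlas B d := chart_at_atlas HB (f p).
have dfp : dom d (f p) := chart_at_dom HB (f p).
rewrite !sff_chart_at /sff_in -/c -/d.
have [U [oU Uz] [Xk UP]] := smooth_chart_nbhs HA HB sf Ac Bd dp dfp.
set X := coord d \o f \o inv c.
have [_ Gsym _] := LC Bd (ex_intro2 _ _ (f p) dfp (erefl _)).
have Xp : X (coord c p) = coord d (f p).
  by rewrite /X /= inv_coord //; exact: (atlas_chart HA Ac).
rewrite (schwarz v u fF oU (Xk 2%N) Uz) Xp.
by rewrite (Gsym ('D_u X _)).
Qed.

(** Linearity is read off the chart formula: the first argument enters as a direction of
    differentiation of C^1 maps and, through one such derivative, as an argument of the Christoffel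
    symbol. *)
Lemma sff_linear p a u v w : h p (a *: u + v) w = a * h p u w + h p v w.
Proof.
pose c := chart_at A p; have Ac : atlas A c := chart_at_atlas HA p.
have dp : dom c p := chart_at_dom HA p.
pose d := chart_at B (f p); have Bd : atlas B d := chart_at_atlas HB (f p).
have dfp : dom d (f p) := chart_at_dom HB (f p).
rewrite !sff_chart_at /sff_in -/c -/d.
have [U [oU Uz] [Xk UP]] := smooth_chart_nbhs HA HB sf Ac Bd dp dfp.
set X := coord d \o f \o inv c.
have fd : (coord d @` dom d) (coord d (f p)) by exists (f p).
have [[_ Glin] _ _] := LC Bd fd.
have Xp : X (coord c p) = coord d (f p).
  by rewrite /X /= inv_coord //; exact: (atlas_chart HA Ac).
have dX : differentiable X (coord c p) := C1_differentiable fE fF oU (Xk 1%N) Uz.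
have dDX : differentiable ('D_w X) (coord c p).
  exact: (C1_differentiable fE fF oU (Ck_on_derive _ (Xk 2%N)) Uz).
rewrite (derive_dirP _ _ _ dDX) (derive_dirP _ _ _ dX) Xp Glin.
rewrite !(tensor_linear gbil _ _ _ _ Bd fd).
have alg (r1 r2 r3 r4 : R) : - (a * r1 + r2 + (a * r3 + r4)) =
    a * - (r1 + r3) + - (r2 + r4) by ring.
exact: alg.
Qed.

End SecondFundamentalForm.

(** * Joint continuity of the metric coefficients and of their first derivatives *)

Section SffContinuity.
Context {R : realType}.

Definition sym_form (F : normedModType R) (b : F -> F -> R) : Prop :=
  (forall r u v w, b (r *: u + v) w = r * b u w + b v w) /\
  (forall u v, b u v = b v u).

Lemma sym_form0 (F : normedModType R) (b : F -> F -> R) w :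
  sym_form b -> b 0 w = 0.
Proof.
move=> [bl _]; have := bl 1 0 0 w; rewrite scaler0 addr0 mul1r => H.
by apply: (addrI (b 0 w)); rewrite -H addr0.
Qed.

Lemma sym_formZ (F : normedModType R) (b : F -> F -> R) r u w :
  sym_form b -> b (r *: u) w = r * b u w.
Proof. by move=> bs; rewrite -[r *: u]addr0 bs.1 sym_form0 // addr0. Qed.

Lemma sym_form_suml (F : normedModType R) (b : F -> F -> R) m (r : nat -> R)
    (e : nat -> F) w : sym_form b ->
  b (\sum_(i < m) r i *: e i) w = \sum_(i < m) r i * b (e i) w.
Proof.
move=> bs; elim: m => [|m IH]; first by rewrite !big_ord0 sym_form0.
by rewrite !big_ord_recr /= -IH addrC bs.1 addrC.
Qed.

(** In finite dimension, convergence of the forms on fixed pairs of vectors suffices for moving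
    arguments: expanding both arguments in coordinates leaves a finite sum of products of convergent
    factors. *)
Lemma sym_form_cvg (F : normedModType R) (S : Type) (G : set_system S)
    (FG : Filter G) (b : S -> F -> F -> R) b0 (u v : S -> F) u0 v0 :
  findim F -> (\forall s \near G, sym_form (b s)) -> sym_form b0 ->
  (forall x y, b s x y @[s --> G] --> b0 x y) ->
  u s @[s --> G] --> u0 -> v s @[s --> G] --> v0 ->
  b s (u s) (v s) @[s --> G] --> b0 u0 v0.
Proof.
move=> [m [e [l [lc lE]]]] bs b0s bb uu vv.
have expand b' x y : sym_form b' ->
    b' x y = \sum_(i < m) l i x * \sum_(j < m) l j y * b' (e j) (e i).
  move=> b's; rewrite {1}(lE x) (sym_form_suml _ (fun i => l i x)) //.
  apply: eq_bigr => i _; congr (_ * _).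
  by rewrite b's.2 {1}(lE y) (sym_form_suml _ (fun i => l i y)).
rewrite (expand b0) //.
apply: (@cvg_trans _ ((fun s => \sum_(i < m) l i (u s) *
    \sum_(j < m) l j (v s) * b s (e j) (e i)) @ G)).
  apply: near_eq_cvg; apply: filterS bs => s bs.
  by apply: esym; exact: expand.
have ll i (w : S -> F) w0 : w s @[s --> G] --> w0 ->
    (l i (w s) : R) @[s --> G] --> (l i w0 : R).
  by move=> ww; apply: (@cvg_comp _ _ _ w (l i) _ _ _ ww); exact: lc.
apply: (@cvg_sum R R^o) => i; apply: cvgM; first exact: ll.
by apply: (@cvg_sum R R^o) => j; apply: cvgM; [exact: ll|exact: bb].
Qed.

Context {F : normedModType R} {N : topologicalType} (B : smooth_structure F N).
Hypotheses (fF : findim F) (HB : is_smooth_manifold B).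
Variable g : N -> F -> F -> R.
Hypothesis gbil : forall q, bilinear_form (g q).
Hypothesis gsym : forall q u v, g q u v = g q v u.
Hypothesis gsmooth : forall c u v, atlas B c ->
  Coo_on (coord c @` dom c) (fun z => tensor_in B g c z u v : R^o).

Variable d : chart F N.
Hypothesis Bd : atlas B d.

Let od : open (coord d @` dom d).
Proof. by have [] := atlas_chart HB Bd. Qed.

Let T (z u v : F) : R^o := tensor_in B g d z u v.

Let T1 u v : Ck_on 1 (coord d @` dom d) (fun z => T z u v).
Proof. exact: gsmooth. Qed.

Lemma tensor_sym_form z : (coord d @` dom d) z -> sym_form (tensor_in B g d z).
Proof.
move=> zd; split=> [r u v w|u v]; last exact: tensor_sym.
exact: (tensor_linear fF HB gbil).
Qed.

Lemma tensor_derivable z u v w : (coord d @` dom d) z ->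
  derivable (fun y => T y u v) z w.
Proof. by move=> zd; apply: ((T1 u v).2 w).1. Qed.

Lemma derive_tensor_sym_form z w : (coord d @` dom d) z ->
  sym_form (fun u v => 'D_w (fun y => T y u v) z).
Proof.
move=> zd; split=> [r u v x|u v].
  have H : is_derive z w (r *: (fun y => T y u x) + (fun y => T y v x))
      (r *: 'D_w (fun y => T y u x) z + 'D_w (fun y => T y v x) z).
    apply: is_deriveD; last exact/derivableP/tensor_derivable.
    exact/is_deriveZ/derivableP/tensor_derivable.
  have [_] := H; apply: etrans; apply: near_eq_derive.
  apply: filterS (open_nbhs_nbhs (conj od zd)) => y yd.
  by rewrite /T (tensor_sym_form yd).1.
congr ('D_w _ z); apply/funext => y; exact: tensor_sym.
Qed.

Section Limits.
Context {S : Type} {G : set_system S} {FG : Filter G}.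
Variables (z u v w : S -> F) (z0 u0 v0 w0 : F).
Hypotheses (zd : (coord d @` dom d) z0) (zz : z s @[s --> G] --> z0).
Hypotheses (uu : u s @[s --> G] --> u0) (vv : v s @[s --> G] --> v0).
Hypothesis (ww : w s @[s --> G] --> w0).

Let nz : \forall s \near G, (coord d @` dom d) (z s).
Proof. by apply: zz; exact: open_nbhs_nbhs. Qed.

Lemma tensor_cvg : tensor_in B g d (z s) (u s) (v s) @[s --> G] -->
  tensor_in B g d z0 u0 v0.
Proof.
apply: (sym_form_cvg (b := fun s => tensor_in B g d (z s))
   (b0 := tensor_in B g d z0) FG fF) => //.
- by apply: filterS nz => s; exact: tensor_sym_form.
- exact: tensor_sym_form.
- move=> x y; apply: (@cvg_comp _ _ _ z (fun z => T z x y) _ _ _ zz).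
  exact: (T1 x y).1.
Qed.

(** Koszul's formula differentiates the metric in directions that vary as well (a derivative of x,
    or the normal), so the direction is expanded in coordinates before the two arguments are. *)
Lemma derive_tensor_cvg : 'D_(w s) (fun y => T y (u s) (v s)) (z s) @[s --> G] -->
  'D_w0 (fun y => T y u0 v0) z0.
Proof.
have [m [e [l [lc lE]]]] := fF.
have expand y a b c : (coord d @` dom d) y -> 'D_c (fun y => T y a b) y =
    \sum_(i < m) (l i c : R^o) * 'D_(e i) (fun y => T y a b) y.
  move=> yd; have dT := C1_differentiable fF (findim_line (R := R)) od (T1 a b) yd.
  rewrite {1}(lE c) (deriveE _ dT) linear_sum; apply: eq_bigr => i _.
  by rewrite linearZ /= (deriveE _ dT).
rewrite (expand z0) //.
apply: (@cvg_trans _ ((fun s => \sum_(i < m) (l i (w s) : R^o) *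
     'D_(e i) (fun y => T y (u s) (v s)) (z s)) @ G)).
  apply: near_eq_cvg; apply: filterS nz => s yd.
  by apply: esym; exact: expand.
apply: (@cvg_sum R R^o) => i; apply: cvgM.
  by apply: (@cvg_comp _ _ _ w (l i) _ _ _ ww); exact: lc.
apply: (sym_form_cvg (b := fun s u v => 'D_(e i) (fun y => T y u v) (z s))
   (b0 := fun u v => 'D_(e i) (fun y => T y u v) z0) FG fF) => //.
- by apply: filterS nz => s; exact: derive_tensor_sym_form.
- exact: derive_tensor_sym_form.
- move=> x y; apply: (@cvg_comp _ _ _ z (fun z => 'D_(e i) (fun z => T z x y) z) _ _ _ zz).
  exact: ((T1 x y).2 (e i)).2.1.
Qed.

End Limits.
End SffContinuity.

(** * Functions of one real variable *)

Section OneVariable.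
Context {R : realType}.
Notation mu := (@lebesgue_measure R).

(* The library's version asks for measurability; the definition by suprema over
   simple functions makes this superfluous, and no regularity of the second
   fundamental form is then needed to compare energies. *)
Lemma le_integral_nomeas (D : set R) (F G : R -> \bar R) :
  (forall x, D x -> (F x <= G x)%E) ->
  (\int[mu]_(x in D) F x <= \int[mu]_(x in D) G x)%E.
Proof.
move=> FG.
have ge0_case (F' G' : R -> \bar R) : (forall x, D x -> (0 <= F' x)%E) ->
    (forall x, D x -> (F' x <= G' x)%E) ->
    (\int[mu]_(x in D) F' x <= \int[mu]_(x in D) G' x)%E.
  move=> F0 F'G'; rewrite !ge0_integralE //; last first.
    by move=> x Dx; exact: le_trans (F0 x Dx) (F'G' x Dx).
  apply: le_ereal_sup => _ [k kF <-]; exists k => // x; apply: le_trans (kF x) _.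
  by rewrite !patchE; case: ifPn => // /set_mem; exact: F'G'.
rewrite [leLHS]integralE [leRHS]integralE.
apply: leeB; apply: ge0_case => x Dx; rewrite ?funepos_ge0 ?funeneg_ge0 //.
  by rewrite !funeposE ge_max !le_max FG //= lexx orbT.
by rewrite !funenegE ge_max !le_max leeN2 FG //= lexx orbT.
Qed.

Lemma integral_cst_itv (a b c : R) : a <= b ->
  (\int[mu]_(x in `[a, b]) c%:E = (c * (b - a))%:E)%E.
Proof.
move=> ab; rewrite integral_cst //= lebesgue_measure_itv /= lte_fin.
case: ltP => [_|ba]; first by rewrite -EFinB -EFinM.
have -> : b = a by apply/eqP; rewrite eq_le ab ba.
by rewrite subrr mulr0 mule0.
Qed.

Lemma FTC_segment (F F' : R -> R) (a b : R) : a < b ->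
  (forall s, a <= s <= b -> is_derive s 1 F (F' s)) ->
  (forall s, a <= s <= b -> {for s, continuous F'}) ->
  (\int[mu]_(s in `[a, b]) (F' s)%:E = (F b - F a)%:E)%E.
Proof.
move=> ab dF cF'.
have cF s : a <= s <= b -> {for s, continuous F}.
  move=> sab; apply: differentiable_continuous; apply/derivable1_diffP.
  by have [] := dF s sab.
rewrite (@continuous_FTC2 _ F' F) ?EFinB //.
- by apply: continuous_in_subspaceT => s /set_mem /=; rewrite in_itv /=; exact: cF'.
- split.
  + by move=> s; rewrite in_itv /= => /andP[/ltW sa /ltW sb]; have [|] := dF s; first by rewrite sa sb.
  + by apply: cvg_at_right_filter; apply: cF; rewrite lexx ltW.
  + by apply: cvg_at_left_filter; apply: cF; rewrite lexx ltW.
- move=> s; rewrite in_itv /= => /andP[/ltW sa /ltW sb].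
  have sab : a <= s <= b by rewrite sa sb.
  by rewrite derive1E; have [_ ->] := dF s sab.
Qed.

(** [Q] is known only through its differences; near [t] it equals [Q a] plus the integral of [q]
    from [a], to which the fundamental theorem of calculus applies. *)
Lemma primitive_is_derive (q Q : R -> R) (a b t : R) : a < t < b ->
  (forall s, a <= s <= b -> {for s, continuous q}) ->
  (forall s s', a <= s -> s < s' -> s' <= b ->
     Q s' - Q s = \int[mu]_(x in `[s, s']) q x) ->
  is_derive t 1 Q (q t).
Proof.
move=> /andP[at_ tb] cq QE.
have iq : mu.-integrable `[a, b] (EFin \o q).
  apply: continuous_compact_integrable; first exact: segment_compact.
  by apply: continuous_in_subspaceT => s /set_mem /=; rewrite in_itv /=; exact: cq.
have ct : {for t, continuous q} by apply: cq; rewrite !ltW.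
have [dF F'E] := continuous_FTC1_closed tb iq at_ ct.
have dF2 : is_derive t 1 (fun y => Q a + \int[mu]_(x in `[a, y]) q x) (0 + q t).
  apply: is_deriveD; rewrite -F'E derive1E; exact: derivableP.
rewrite add0r in dF2; apply: near_eq_is_derive dF2.
have na : \forall s \near t, a < s by exact: lt_nbhsr.
have nb : \forall s \near t, s < b by exact: lt_nbhsl.
near=> s; rewrite -QE ?subrKC //; near: s => //.
by apply: filterS nb => s /ltW.
Unshelve. all: by end_near. Qed.

Lemma growth_le (L : R -> R) (t l C : R) : is_derive t 1 L l ->
  (\forall s \near t, t < s -> L s - L t <= C * (s - t)) -> l <= C.
Proof.
move=> [dL <-] LC.
apply/ler_addgt0Pr => e e0.
have /cvgrPdist_lt/(_ _ e0)[d /= d0 dP] := dL.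
have /nbhs_ballP[d' /= d'0 d'P] := LC.
(* A step inside both radii: the difference quotient is [e]-close to the derivative, and the growth
   bound is available. *)
pose m := Num.min d d' / 2.
have m0 : 0 < m by rewrite divr_gt0 // lt_min d0.
have mm : m < Num.min d d'.
  by rewrite ltr_pdivrMr // ltr_pMr ?ltr1n // lt_min d0.
move: mm; rewrite lt_min => /andP[md md'].
have H : `|'D_1 L t - m^-1 *: ((L \o shift t) (m *: 1) - L t)| < e.
  apply: dP; last exact: lt0r_neq0.
  by rewrite /ball_ /= sub0r normrN gtr0_norm.
have /d'P LCm : ball t d' (m + t).
  by rewrite /ball /= distrC addrK gtr0_norm.
have {LCm} := LCm _; rewrite ltrDr addrK => /(_ m0) LCm.
have q : m^-1 * (L (m + t) - L t) <= C.
  by rewrite [_ * _]mulrC ler_pdivrMr.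
move: H; rewrite /= [m *: 1]mulr1 => /ltW /(le_trans (ler_norm _)).
by rewrite lerBlDr => /le_trans; apply; rewrite addrC lerD2r.
Qed.

Lemma growth_ge (L : R -> R) (t l C : R) : is_derive t 1 L l ->
  (\forall s \near t, t < s -> C * (s - t) <= L s - L t) -> C <= l.
Proof.
move=> dL LC; rewrite -lerN2.
have dNL : is_derive t 1 (- L) (- l) by exact: is_deriveN.
apply: (growth_le dNL); apply: filterS LC => s LC /LC; by rewrite !fctE mulNr -opprD lerN2.
Qed.

(** [B] is continuous at the single point [t], so instead of differentiating its integral one bounds
    [B] by the constant [B t + e] on a short interval and integrates that constant. *)
Lemma derive_le_density (L B : R -> R) (t l : R) : is_derive t 1 L l ->
  {for t, continuous B} ->
  (\forall s \near t, t < s ->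
     ((L s - L t)%:E <= \int[mu]_(x in `[t, s]) (B x)%:E)%E) ->
  l <= B t.
Proof.
move=> dL cB LB; apply/ler_addgt0Pr => e e0.
apply: growth_le dL _.
have /cvgrPdist_lt/(_ _ e0)/nbhs_ballP[d /= d0 dP] := cB.
have n2 : \forall s \near t, s < t + d by apply: lt_nbhsl; rewrite ltrDl.
apply: filterS2 LB n2 => s LB sd ts; rewrite -lee_fin.
apply: le_trans (LB ts) _.
rewrite -integral_cst_itv ?(ltW ts) //; apply: le_integral_nomeas => y /=.
rewrite in_itv /= => /andP[ty ys]; rewrite lee_fin addrC -lerBlDr.
have : ball t d y by rewrite /ball /= distrC ger0_norm ?subr_ge0 // ltrBlDl (le_lt_trans ys).
move=> /dP; rewrite distrC => /ltW; exact: le_trans (ler_norm _).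
Qed.

Lemma density_le_derive (L B : R -> R) (t l : R) : is_derive t 1 L l ->
  {for t, continuous B} ->
  (\forall s \near t, t < s ->
     (\int[mu]_(x in `[t, s]) (B x)%:E <= (L s - L t)%:E)%E) ->
  B t <= l.
Proof.
move=> dL cB LB; apply/ler_addgt0Pr => e e0; rewrite -lerBlDr.
apply: growth_ge dL _.
have /cvgrPdist_lt/(_ _ e0)/nbhs_ballP[d /= d0 dP] := cB.
have n2 : \forall s \near t, s < t + d by apply: lt_nbhsl; rewrite ltrDl.
apply: filterS2 LB n2 => s LB sd ts; rewrite -lee_fin.
apply: le_trans _ (LB ts).
rewrite -integral_cst_itv ?(ltW ts) //; apply: le_integral_nomeas => y /=.
rewrite in_itv /= => /andP[ty ys]; rewrite lee_fin lerBlDr -lerBlDl.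
have : ball t d y by rewrite /ball /= distrC ger0_norm ?subr_ge0 // ltrBlDl (le_lt_trans ys).
move=> /dP /ltW; exact: le_trans (ler_norm _).
Qed.

Lemma is_derive_ln_norm (F : R -> R) (t F' : R) : F t != 0 ->
  is_derive t 1 F F' -> is_derive t 1 (fun s => ln `|F s|) (F' / F t).
Proof.
move=> Ft0 dF.
have cF : F s @[s --> t] --> F t.
  by apply: differentiable_continuous; apply/derivable1_diffP; case: dF.
case: (ltrgt0P (F t)) Ft0 => // Ft _.
- have dl : is_derive t 1 (@ln R \o F) ((F t)^-1 * F').
    by apply: is_derive1_comp; exact: is_derive1_ln.
  rewrite mulrC; apply: near_eq_is_derive dl.
  have n : \forall s \near t, 0 < F s by exact: (cvgr_gt _ cF).
  by apply: filterS n => s Fs /=; rewrite gtr0_norm.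
- have Nt : 0 < (- F) t by rewrite fctE oppr_gt0.
  have dN : is_derive t 1 (- F) (- F') by exact: is_deriveN.
  have dl : is_derive t 1 (@ln R \o (- F)) (((- F) t)^-1 * - F').
    by apply: is_derive1_comp; exact: is_derive1_ln.
  have -> : F' / F t = ((- F) t)^-1 * - F' by rewrite fctE invrN mulrNN mulrC.
  apply: near_eq_is_derive dl.
  have n : \forall s \near t, F s < 0 by exact: (cvgr_lt _ cF).
  by apply: filterS n => s Fs /=; rewrite ltr0_norm.
Qed.

Lemma connected_sign (T : topologicalType) (A : set T) (F : T -> R) p q :
  connected A -> {within A, continuous F} -> (forall r, A r -> F r != 0) ->
  A p -> A q -> 0 < F p -> 0 < F q.
Proof.
move=> cA cF F0 Ap Aq Fp; rewrite ltNge; apply/negP => Fq.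
have /connected_intervalP iF := connected_continuous_connected cA cF.
have : (F @` A) 0.
  apply: (iF (F q) (F p)); [by exists q|by exists p|].
  by rewrite Fq ltW.
by move=> [r Ar Fr]; have := F0 r Ar; rewrite Fr eqxx.
Qed.

(** For finite [D] take logarithms and multiply by 4. For [D = +oo] both sides are true; for
    [D = -oo] the exponential is 0 and both are false. *)
Lemma harnack_exp_pos (f1 f2 Q1 Q2 : R) (D : \bar R) : 0 < f1 -> 0 < f2 ->
  (f1%:E <= (expR Q2 / expR Q1)%:E * expeR (D * (4^-1)%:E) * f2%:E)%E =
  ((- 4 * (ln `|f2| + Q2 - (ln `|f1| + Q1)))%:E <= D)%E.
Proof.
move=> f10 f20; rewrite !gtr0_norm //; case: D => [r| |] /=.
- rewrite -!EFinM !lee_fin.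
  rewrite -{1}(lnK f10) -{1}(lnK f20) -expRN -!expRD ler_expR.
  by apply/idP/idP; lra.
- by rewrite gt0_mulye ?lte_fin ?invr_gt0 //= gt0_muley ?lte_fin ?divr_gt0 ?expR_gt0 //
     gt0_mulye ?lte_fin // !leey.
- by rewrite gt0_mulNye ?lte_fin ?invr_gt0 //= mule0 mul0e lee_fin leNgt f10.
Qed.

(** Negating both values reverses the inequality before logarithms are taken. The infinite cases
    swap: [D = +oo] makes both sides false and [D = -oo] makes both true. *)
Lemma harnack_exp_neg (f1 f2 Q1 Q2 : R) (D : \bar R) : f1 < 0 -> f2 < 0 ->
  (f1%:E <= (expR Q2 / expR Q1)%:E * expeR (D * (4^-1)%:E) * f2%:E)%E =
  (D <= (- 4 * (ln `|f2| + Q2 - (ln `|f1| + Q1)))%:E)%E.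
Proof.
move=> f10 f20; rewrite !ltr0_norm //; move: f10 f20; rewrite -oppr_gt0 => f10; rewrite -oppr_gt0 => f20; case: D => [r| |] /=.
- rewrite -!EFinM !lee_fin -lerN2 -mulrN.
  rewrite -{1}(lnK f10) -{1}(lnK f20) -expRN -!expRD ler_expR.
  by apply/idP/idP; lra.
- rewrite gt0_mulye ?lte_fin ?invr_gt0 //= gt0_muley ?lte_fin ?divr_gt0 ?expR_gt0 //.
  by rewrite lt0_mulye ?lte_fin -?oppr_gt0 // leNgt ltNyr leNgt ltry.
- rewrite gt0_mulNye ?lte_fin ?invr_gt0 //= mule0 mul0e lee_fin leNye.
  by rewrite -oppr_ge0 ltW.
Qed.

End OneVariable.

(** * Time-dependent maps *)

Section ChartsOfMaps.
Context {R : realType} {E F : normedModType R} {M N : topologicalType}.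
Context (A : smooth_structure E M) (B : smooth_structure F N).
Variables (U : set M) (f : M -> N) (c : chart E M) (d : chart F N) (p : M).
Hypotheses (oU : open U) (sf : smooth_on A B U f).
Hypotheses (Ac : atlas A c) (Bd : atlas B d) (cM : is_chart c) (dN : is_chart d).
Hypotheses (Up : U p) (dp : dom c p) (dfp : dom d (f p)).

Let D := coord c @` (dom c `&` U `&` f @^-1` dom d).

Lemma smooth_domain_props : [/\ open D, D (coord c p) &
  forall z, D z -> [/\ dom c (inv c z), U (inv c z), dom d (f (inv c z)) &
                       coord c (inv c z) = z]].
Proof.
split; last by move=> z [q [[dq Uq] dfq] <-]; rewrite inv_coord.
- by apply: open_smooth_domain => //; exact: sf.1.
- by exists p.
Qed.

Lemma smooth_on_chart k : Ck_on k D (coord d \o f \o inv c).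
Proof. exact: sf.2. Qed.

Lemma smooth_field_on_chart k V : smooth_field_on A B U f V ->
  Ck_on k D (fun z => comps B d (f (inv c z)) (V (inv c z))).
Proof. by move=> sV; exact: sV. Qed.

End ChartsOfMaps.

Section TimeDependent.
Context {R : realType} {n : nat} {M : topologicalType}.
Context (SM : smooth_structure ('rV[R]_n : normedModType R) M).
Hypothesis HM : is_smooth_manifold SM.
Notation E := ('rV[R]_n : normedModType R).
Notation line_chart := (chart_at (@line R) 0).

Lemma product_chart c : atlas SM c ->
  atlas (prod_structure SM (@line R)) (prod_chart c line_chart) /\
  is_chart (prod_chart c line_chart).
Proof.
move=> Ac; split; first by exists c, line_chart.
apply: is_chart_prod; last exact: is_chart_line.
exact: (atlas_chart HM).
Qed.

Lemma findim_space_time : findim ((E * R^o)%type : normedModType R).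
Proof. by apply: findim_prod; [exact: findim_rV|exact: findim_line]. Qed.

Lemma open_time_interval (T : \bar R) :
  open [set t : R | 0 < t /\ (t%:E < T)%E].
Proof.
have oT : open [set t : R | (t%:E < T)%E].
  case: T => [r| |].
  - rewrite (_ : [set _ | _] = [set t | t < r]); first exact: open_lt.
    by apply/seteqP; split => t /=; rewrite lte_fin.
  - rewrite (_ : [set _ | _] = setT); first exact: openT.
    by apply/seteqP; split => t //= _; rewrite ltry.
  - rewrite (_ : [set _ | _] = set0); first exact: open0.
    by apply/seteqP; split => t //=.
by apply: openI => //; exact: open_gt.
Qed.

Lemma open_time_strip (T : \bar R) :
  open [set pt : M * R | 0 < pt.2 /\ (pt.2%:E < T)%E].
Proof.
rewrite -[X in open X]setTI.
exact: (@open_preimage (M * R)%type R setT [set t : R | 0 < t /\ (t%:E < T)%E]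
  snd openT (fun p _ => cvg_snd) (@open_time_interval T)).
Qed.

Variables (U : set (M * R)) (f : M * R -> R).
Hypothesis oU : open U.
Hypothesis sf : smooth_on (prod_structure SM (@line R)) (@line R) U f.

Let in_chart (c : chart E M) (zs : E * R^o) : R^o := f (inv c zs.1, zs.2).

Lemma real_chart_nbhs c p t : atlas SM c -> dom c p -> U (p, t) ->
  exists2 D : set (E * R^o)%type, open D /\ D (coord c p, t) &
    (forall k, Ck_on k D (in_chart c)).
Proof.
move=> Ac dp Upt; have [Ac' cM'] := product_chart Ac.
have lM : is_chart line_chart by exact: is_chart_line.
have [oD Dp _] := smooth_domain_props (d := line_chart) oU sf cM' lM Upt
  (conj dp I) I.
eexists; first by split; [exact: oD|exact: Dp].
by move=> k; exact: (smooth_on_chart sf).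
Qed.

(** Joint differentiability makes the derivative additive in (u, 1) = (u, 0) + (0, 1), and each
    summand is a derivative within a slice. *)
Lemma space_time_derive p t u : U (p, t) ->
  'D_(u, 1) (in_chart (chart_at SM p)) (coord (chart_at SM p) p, t) =
  derive1 (fun s => f (p, s) : R^o) t + vdiff SM (fun q => f (q, t) : R^o) p u.
Proof.
move=> Upt; set c := chart_at SM p.
have Ac : atlas SM c := chart_at_atlas HM p.
have dp : dom c p := chart_at_dom HM p.
have [D [oD Dp] Dk] := real_chart_nbhs Ac dp Upt.
have dF := C1_differentiable findim_space_time (findim_line (R := R)) oD (Dk 1%N) Dp.
have -> : (u, 1) = 1 *: (u, 0) + (0, 1) :> (E * R^o)%type.
  by rewrite scale1r; congr pair; rewrite /= ?addr0 ?add0r.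
rewrite (derive_dirP _ _ _ dF) scale1r addrC; congr (_ + _).
  rewrite derive1E.
  have aff h : (coord c p, h *: 1 + t) = h *: (0, 1) + (coord c p, t) :> (E * R^o)%type.
    by congr pair; rewrite /= scaler0 add0r.
  have := (derive_affine (in_chart c) (g := fun s : R^o => (coord c p, s)) aff).1.
  move=> <-; congr ('D_1 _ t); apply/funext => s.
  by rewrite /in_chart /= inv_coord //; exact: (atlas_chart HM).
have aff h : (h *: u + coord c p, t) = h *: (u, 0) + (coord c p, t) :> (E * R^o)%type.
  by congr pair; rewrite /= scaler0 add0r.
by have := (derive_affine (in_chart c) (g := fun z : E => (z, t)) aff).1 => <-.
Qed.

Section AlongCurve.
Variables (V : set R) (gamma : R -> M) (s0 : R).
Hypotheses (oV : open V) (sg : smooth_on (@line R) SM V gamma) (Vs0 : V s0).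
Hypothesis Ugs0 : U (gamma s0, s0).

(** In a space-time chart [f (gamma s, s)] is a smooth function composed with the graph [kap] of the
    curve; the neighbourhood is shrunk until this graph stays in the chart. *)
Lemma curve_C1 : exists2 V' : set R^o, open V' /\ V' s0 &
  Ck_on 1 V' (fun s : R^o => f (gamma s, s) : R^o).
Proof.
set c := chart_at SM (gamma s0).
have Ac : atlas SM c := chart_at_atlas HM (gamma s0).
have dp : dom c (gamma s0) := chart_at_dom HM (gamma s0).
have [D [oD Dp] Dk] := real_chart_nbhs Ac dp Ugs0.
have lM : is_chart line_chart by exact: is_chart_line.
have cM := atlas_chart HM Ac.
have [oD' D's0 D'P] := smooth_domain_props (c := line_chart) oV sg lM cM Vs0 I dp.
have Dk' := smooth_on_chart sg (c := line_chart) (d := c) erefl Ac.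
set D' := _ @` _ in oD' D's0 D'P Dk'.
pose kap (s : R^o) : (E * R^o)%type := (coord c (gamma s), s).
have kapk k : Ck_on k D' kap.
  by apply: Ck_on_pair => //; exact: Ck_on_id.
have oV' : open (D' `&` kap @^-1` D).
  apply: (open_preimage oD' _ oD) => s Ds; exact: (kapk 0%N).1.
exists (D' `&` kap @^-1` D); first by split.
have H : Ck_on 1 (D' `&` kap @^-1` D) (in_chart c \o kap).
  apply: (Ck_on_comp findim_space_time (findim_line (R := R)) oD oV' _ (Dk 1%N)).
    by move=> s [].
  by apply: Ck_on_sub (kapk 1%N) => s [].
apply: Ck_on_ext H => // s [/D'P[_ _ ds _] _].
by rewrite /in_chart /= inv_coord.
Qed.

Lemma curve_is_derive : is_derive s0 1 (fun s : R^o => f (gamma s, s) : R^o)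
  (derive1 (fun s => f (gamma s0, s) : R^o) s0 +
   vdiff SM (fun q => f (q, s0) : R^o) (gamma s0) (velocity SM gamma s0)).
Proof.
rewrite -space_time_derive //; set c := chart_at SM (gamma s0).
have Ac : atlas SM c := chart_at_atlas HM (gamma s0).
have dp : dom c (gamma s0) := chart_at_dom HM (gamma s0).
have [D [oD Dp] Dk] := real_chart_nbhs Ac dp Ugs0.
have lM : is_chart line_chart by exact: is_chart_line.
have cM := atlas_chart HM Ac.
have [oD' D's0 D'P] := smooth_domain_props (c := line_chart) oV sg lM cM Vs0 I dp.
have Dk' := smooth_on_chart sg (c := line_chart) (d := c) erefl Ac.
set D' := _ @` _ in oD' D's0 D'P Dk'.
pose kap (s : R^o) : (E * R^o)%type := (coord c (gamma s), s).
have dkap : is_derive s0 1 kap (velocity SM gamma s0, 1).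
  have dc : is_derive s0 1 (fun s : R^o => coord c (gamma s) : E)
      (velocity SM gamma s0).
    by apply: derivableP; exact: ((Dk' 1%N).2 1).1.
  exact: is_derive_pair dc (is_derive_id _ _).
have dF := C1_differentiable findim_space_time (findim_line (R := R)) oD (Dk 1%N) Dp.
apply: near_eq_is_derive (chain_rule (F := in_chart c) dF dkap).
apply: filterS (open_nbhs_nbhs (conj oD' D's0)) => s /D'P[_ _ ds _].
by rewrite /in_chart /= inv_coord.
Qed.

End AlongCurve.
End TimeDependent.

(** * Curves that are straight in a chart *)

Section StraightCurve.
Context {R : realType} {n : nat} {M : topologicalType}.
Context (SM : smooth_structure ('rV[R]_n : normedModType R) M).
Hypothesis HM : is_smooth_manifold SM.
Notation E := ('rV[R]_n : normedModType R).
Variables (c : chart E M) (z : E) (t : R) (w : E).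

Definition straight (s : R) : E := z + (s - t) *: w.

Lemma straight0 : straight t = z.
Proof. by rewrite /straight subrr scale0r addr0. Qed.

Lemma straight_affine (s h : R) : straight (h * 1 + s) = h *: w + straight s.
Proof. by rewrite /straight mulr1 -addrA scalerDl addrCA. Qed.

Lemma straight_Ck k U : Ck_on k U (straight : R^o -> E).
Proof.
apply: (@Ck_on_sub _ _ _ _ setT) => //.
apply: (@Ck_on_add R R^o E k setT (fun=> z) (fun s => (s - t) *: w) openT).
  exact: Ck_on_cst.
apply: (@Ck_on_scale R R^o E k setT (fun s => s - t) (fun=> w) openT); last exact: Ck_on_cst.
apply: (@Ck_on_add R R^o R^o k setT id (fun=> - t) openT).
  exact: Ck_on_id.
exact: Ck_on_cst.
Qed.

Lemma straight_continuous (s : R) : {for s, continuous straight}.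
Proof. exact: (straight_Ck 0 setT).1. Qed.

Hypotheses (Ac : atlas SM c) (zd : (coord c @` dom c) z).

Definition straight_curve (s : R) : M := inv c (straight s).

Lemma straight_near : exists2 r : R, 0 < r &
  forall s, t - r < s < t + r -> (coord c @` dom c) (straight s).
Proof.
have [_ oi _ _ _] := atlas_chart HM Ac.
have : \forall s \near t, (coord c @` dom c) (straight s).
  have H : straight @ t --> straight t := @straight_continuous t.
  by apply: H; rewrite straight0; exact: open_nbhs_nbhs.
move=> /nbhs_ballP[r /= r0 rP]; exists r => // s /andP[s1 s2].
by apply: rP; rewrite /ball /= ltr_norml; apply/andP; split; lra.
Qed.

Section OnSet.
Variable V : set R.
Hypotheses (oV : open V) (VP : forall s, V s -> (coord c @` dom c) (straight s)).

Lemma straight_curve_coord s : V s ->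
  dom c (straight_curve s) /\ coord c (straight_curve s) = straight s.
Proof.
move=> /VP[q dq qE]; rewrite /straight_curve -qE inv_coord //.
exact: (atlas_chart HM).
Qed.

Lemma straight_curve_smooth : smooth_on (@line R) SM V straight_curve.
Proof.
have cM := atlas_chart HM Ac; have [_ _ _ _ ci] := cM.
have cont s : V s -> {for s, continuous straight_curve}.
  move=> Vs; apply: (@continuous_comp _ _ _ straight (inv c)).
    exact: straight_continuous.
  by apply: ci; exact: VP.
split=> // l d -> Ad k.
have dM := atlas_chart HM Ad.
have oD := @open_smooth_domain R R^o E R M V straight_curve _ d oV cont
  (is_chart_line (erefl : atlas (@line R) (chart_at (@line R) 0))) dM.
have [_ _ _ compat _] := HM.
apply: (@Ck_on_comp R E R^o E k _ _ (coord d \o inv c) straight _ _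
  (open_overlap HM Ac Ad) oD).
- exact: findim_rV.
- exact: findim_rV.
- move=> _ [s [[_ Vs] ds] <-] /=; have [dc cE] := straight_curve_coord Vs.
  by exists (straight_curve s).
- exact: compat.
- exact: straight_Ck.
Qed.

(** [velocity] is expressed in a preferred chart that may change with [s], whereas the components in
    [c] stay equal to [w]. *)
Lemma straight_curve_velocity s : V s ->
  velocity SM straight_curve s = tvec SM c (straight_curve s) w.
Proof.
move=> Vs; have [dc cE] := straight_curve_coord Vs.
rewrite /tvec cE /velocity /mdiff /vdiff /=.
set c' := chart_at SM _.
exact: (derive_affine (coord c' \o inv c) (g := straight : R^o -> E)
  (straight_affine s)).1.
Qed.

End OnSet.

Lemma smooth_on_sub (V V' : set R) (gamma : R -> M) : V' `<=` V ->
  smooth_on (@line R) SM V gamma -> smooth_on (@line R) SM V' gamma.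
Proof.
move=> V'V [gc gs]; split=> [s /V'V|l d Al Ad k]; first exact: gc.
apply: Ck_on_sub (gs l d Al Ad k) => _ [s [[ds Vs] dd] <-].
by exists s => //; split => //; split => //; exact: V'V.
Qed.

End StraightCurve.

(** * Continuity in time of the second fundamental form along a straight curve *)

Section SffAlongStraightCurve.
Context {R : realType} {n m : nat} {M N : topologicalType}.
Notation E := ('rV[R]_n : normedModType R).
Notation F := ('rV[R]_m : normedModType R).
Context (SM : smooth_structure E M) (SN : smooth_structure F N).
Hypotheses (HM : is_smooth_manifold SM) (HN : is_smooth_manifold SN).
Variables (g : N -> F -> F -> R) (GN : chart F N -> F -> F -> F -> F).
Hypothesis gbil : forall q, bilinear_form (g q).
Hypothesis gsym : forall q u v, g q u v = g q v u.
Hypothesis gsmooth : forall c u v, atlas SN c ->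
  Coo_on (coord c @` dom c) (fun z => tensor_in SN g c z u v : R^o).
Hypothesis LC : is_levi_civita SN g GN.
Variables (U : set (M * R)) (x : M * R -> N) (nu : M * R -> F).
Variable h : M * R -> E -> E -> R.
Hypotheses (oU : open U) (sx : smooth_on (prod_structure SM (@line R)) SN U x).
Hypothesis snu : smooth_field_on (prod_structure SM (@line R)) SN U x nu.
Hypothesis hE : forall c d p t w, U (p, t) -> atlas SM c -> atlas SN d ->
  dom c p -> dom d (x (p, t)) ->
  h (p, t) (tvec SM c p w) (tvec SM c p w) =
  sff_in SN g GN (fun q => x (q, t)) c d (coord c p) w w
    (comps SN d (x (p, t)) (nu (p, t))).

Variables (c : chart E M) (p : M) (t : R) (w : E).
Hypotheses (Ac : atlas SM c) (dp : dom c p) (Upt : U (p, t)).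

Let gam := straight_curve c (coord c p) t w.

(** Along the curve the value of [h] is the chart expression with constant [w]. Once Koszul's
    formula has removed the Christoffel symbols, only x, nu and the metric coefficients remain, all
    smooth in charts of space-time and of N. *)
Lemma sff_straight_continuous (V : set R) : open V -> V t ->
  (forall s, V s -> (coord c @` dom c) (straight (coord c p) t w s)) ->
  {for t, continuous (fun s =>
     h (gam s, s) (velocity SM gam s) (velocity SM gam s))}.
Proof.
move=> oV Vt VP.
set l := straight (coord c p) t w in VP.
have cM := atlas_chart HM Ac.
pose d := chart_at SN (x (p, t)); have Ad : atlas SN d := chart_at_atlas HN _.
have dd : dom d (x (p, t)) := chart_at_dom HN _.
have dN := atlas_chart HN Ad.
have [Ac' cM'] := product_chart HM Ac.
have [oD Dp DP] := smooth_domain_props (d := d) oU sx cM' dN Upt (conj dp I) dd.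
have XXk k := smooth_on_chart sx Ac' Ad k.
have nuk := smooth_field_on_chart Ac' Ad 0 snu.
set D := _ @` _ in oD Dp DP XXk nuk.
set XX := _ \o _ in XXk.
set b := (fun z => _) in nuk.
pose kap (s : R) : (E * R^o)%type := (l s, s).
pose w' : (E * R^o)%type := (w, 0).
have kapt : kap t = (coord c p, t) by rewrite /kap /l straight0.
have kapc : kap @ t --> kap t.
  apply: (@cvg_pair _ _ _ _ (nbhs (l t)) (nbhs t)); last exact: cvg_id.
  exact: straight_continuous.
have Dkt : D (kap t) by rewrite kapt.
have nD : \forall s \near t, D (kap s).
  by apply: kapc; exact: open_nbhs_nbhs.
have lim (W : normedModType R) (G : (E * R^o)%type -> W) : Ck_on 0 D G ->
    G (kap s) @[s --> t] --> G (kap t).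
  move=> [cG _]; apply: (@cvg_comp _ _ _ kap G _ _ _ kapc).
  exact: cG.
have XXt : (coord d @` dom d) (XX (kap t)).
  by have [_ _ dx _] := DP _ Dkt; eexists; first exact: dx.
have zl := lim _ XX (XXk 0%N).
have al := lim _ _ (Ck_on_derive w' (XXk 1%N)).
have a2l := lim _ _ (Ck_on_derive w' (Ck_on_derive w' (XXk 2%N))).
have bl := lim _ b nuk.
have fF : findim F by exact: findim_rV.
pose T := tensor_in SN g d.
(* This is [sff_in] on the diagonal, with the Christoffel term replaced by the right-hand side of
   [koszul] and spatial derivatives written as space-time derivatives along [w']. *)
pose K (zs : (E * R^o)%type) : R :=
  - (T (XX zs) ('D_w' ('D_w' XX) zs) (b zs) +
     ('D_('D_w' XX zs) (fun y => T y ('D_w' XX zs) (b zs) : R^o) (XX zs) -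
      2^-1 * 'D_(b zs) (fun y => T y ('D_w' XX zs) ('D_w' XX zs) : R^o) (XX zs))).
have Kl : K (kap s) @[s --> t] --> K (kap t).
  have l1 := tensor_cvg fF HN gbil gsym gsmooth Ad XXt zl a2l bl.
  have l2 := derive_tensor_cvg fF HN gbil gsym gsmooth Ad XXt zl al bl al.
  have l3 := derive_tensor_cvg fF HN gbil gsym gsmooth Ad XXt zl al al bl.
  exact: (cvgN (cvgD (l1 _) (cvgB (l2 _) (cvgM (cvg_cst _) (l3 _))))).
apply: near_eq_continuous Kl.
have nV : \forall s \near t, V s by exact: open_nbhs_nbhs.
apply: filterS2 nD nV => s Ds Vs.
have [[dcs _] Us dxs _] := DP _ Ds.
have [dc cE] := straight_curve_coord HM Ac VP Vs.
rewrite (straight_curve_velocity HM Ac VP Vs) (hE w Us Ac Ad dcs dxs).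
rewrite -/gam in cE *; rewrite [coord c _]cE -/l.
rewrite /sff_in /K.
(* At a fixed time [s], a derivative along [w] is a space-time derivative along (w, 0); applied
   twice, this expresses the slice [X] through [XX]. *)
have aff (y : E) (k : R) : (k *: w + y, s) = k *: w' + (y, s) :> (E * R^o)%type.
  by congr pair; rewrite /= scaler0 add0r.
set X := coord d \o (fun q => x (q, s)) \o inv c.
have D1 : 'D_w X = (fun y : E => 'D_w' XX (y, s)).
  apply/funext => y.
  exact: (derive_affine XX (g := fun y : E => (y, s)) (aff y)).1.
have D2 : 'D_w ('D_w X) (l s) = 'D_w' ('D_w' XX) (kap s).
  rewrite D1.
  exact: (derive_affine ('D_w' XX) (g := fun y : E => (y, s)) (aff (l s))).1.
have D1s : 'D_w X (l s) = 'D_w' XX (kap s) := f_equal (fun G => G (l s)) D1.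
rewrite D2 D1s.
have XXs : (coord d @` dom d) (X (l s)) by eexists; first exact: dxs.
by rewrite (koszul gsym _ _ LC Ad XXs).
Qed.

End SffAlongStraightCurve.

(** * The Harnack inequality *)

Section Harnack.
Context {R : realType} {n m : nat} {M N : topologicalType}.
Notation E := ('rV[R]_n : normedModType R).
Notation F := ('rV[R]_m : normedModType R).
Context (SM : smooth_structure E M) (SN : smooth_structure F N).
Hypotheses (HM : is_smooth_manifold SM) (HN : is_smooth_manifold SN).
Variables (g : N -> F -> F -> R) (GN : chart F N -> F -> F -> F -> F).
Hypothesis Hg : is_semi_riemannian SN g.
Hypothesis LC : is_levi_civita SN g GN.
Hypothesis Mconn : connected [set: M].
Variable Tstar : \bar R.
Notation time t := (0 < t /\ (t%:E < Tstar)%E).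
Notation strip := [set pt : M * R | 0 < pt.2 /\ (pt.2%:E < Tstar)%E].
Notation SMt := (prod_structure SM (@line R)).
Variables (x : M * R -> N) (nu : M * R -> F) (sigma : R).
Hypothesis sx : smooth_on SMt SN strip x.
Hypothesis sxt : forall t, time t -> smooth_on SM SN setT (fun p => x (p, t)).
Hypothesis sigma2 : sigma * sigma = 1.
Hypothesis snu : smooth_field_on SMt SN strip x nu.
Hypothesis nuunit : forall p t, time t -> g (x (p, t)) (nu (p, t)) (nu (p, t)) = sigma.
Hypothesis nunormal : forall p t u, time t ->
  g (x (p, t)) (nu (p, t)) (mdiff SM SN (fun q => x (q, t)) p u) = 0.
Variable GM : R -> chart E M -> E -> E -> E -> E.
Variable h : M * R -> E -> E -> R.
Hypothesis Hh : forall t, time t ->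
  is_second_fundamental_form SM SN (GM t) GN (fun p => x (p, t))
    (fun p => nu (p, t)) sigma (fun p => h (p, t)).
Hypothesis hconvex : forall p t u, time t -> u != 0 -> 0 < h (p, t) u u.
Variable f : M * R -> R.
Hypothesis sf : smooth_on SMt (@line R) strip f.
Hypothesis f0 : forall p t, time t -> f (p, t) != 0.
Variable gradf : M * R -> E.
Hypothesis Hgrad : forall p t u, time t ->
  h (p, t) (gradf (p, t)) u = vdiff SM (fun q => f (q, t) : R^o) p u.

Let fE : findim E. Proof. exact: findim_rV. Qed.
Let fF : findim F. Proof. exact: findim_rV. Qed.
Let ostrip : open strip. Proof. exact: open_time_strip. Qed.

Let gbil q : bilinear_form (g q).
Proof. by case: Hg => /(_ q)[]. Qed.

Let gsym q u v : g q u v = g q v u.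
Proof. by case: Hg => /(_ q)[_]. Qed.

Lemma h_sym_form p t : time t -> sym_form (h (p, t)).
Proof.
move=> tT; split=> [r u v w|u v].
- exact: (sff_linear fE fF HM HN gbil gsym LC (sxt tT) sigma2
    (fun p => nuunit p tT) (fun p u => nunormal p u tT) (Hh tT)).
- exact: (sff_sym fE fF HM HN gbil gsym LC (sxt tT) sigma2
    (fun p => nuunit p tT) (fun p u => nunormal p u tT) (Hh tT)).
Qed.

Lemma h_ge0 p t u : time t -> 0 <= h (p, t) u u.
Proof.
move=> tT; have [->|u0] := eqVneq u 0; last exact/ltW/hconvex.
by rewrite sym_form0 //; exact: h_sym_form.
Qed.

Lemma h_square p t u v : time t ->
  0 <= h (p, t) u u + h (p, t) u v + h (p, t) v v / 4.
Proof.
move=> tT; have [hl hs] := h_sym_form p tT.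
have := h_ge0 p (2^-1 *: v + u) tT.
rewrite hl (hs v) (hs u) !hl (hs v u).
set a := h _ u u; set b := h _ u v; set c := h _ v v; lra.
Qed.

Lemma h_opp2 p t u : time t -> h (p, t) (- 2 *: u) (- 2 *: u) = 4 * h (p, t) u u.
Proof.
move=> tT; have hs := h_sym_form p tT.
by rewrite sym_formZ // hs.2 sym_formZ // mulrA; congr (_ * _); lra.
Qed.

Lemma f_continuous p t : time t -> {for (p, t), continuous f}.
Proof. by move=> tT; apply: sf.1. Qed.

(** The sign is carried first from [p] to [q] at time [s], by connectedness of M, and then along the
    time segment between [s] and [t] at the point [q]. *)
Lemma f_sign p q s t : time s -> time t -> 0 < f (p, s) -> 0 < f (q, t).
Proof.
move=> sT tT fps.
have {fps} fqs : 0 < f (q, s).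
  apply: (connected_sign (F := fun r => f (r, s)) (p := p) Mconn) => //.
    apply: continuous_subspaceT => r.
    apply: (@cvg_comp _ _ _ (fun r => (r, s)) f _ (nbhs (r, s))).
      by apply: (@cvg_pair _ _ _ _ (nbhs r) (nbhs s)); [exact: cvg_id|exact: cvg_cst].
    exact: f_continuous.
  by move=> r _; exact: f0.
have iT r : Num.min s t <= r <= Num.max s t -> time r.
  move=> /andP[r1 r2]; split.
    by apply: lt_le_trans r1; rewrite lt_min sT.1 tT.1.
  apply: (@le_lt_trans _ _ (Num.max s t)%:E); first by rewrite lee_fin.
  by case: (leP s t) => _; [exact: tT.2|exact: sT.2].
apply: (connected_sign (F := fun r => f (q, r)) (p := s)
  (@segment_connected R (Num.min s t) (Num.max s t))) => //.
- apply: continuous_in_subspaceT => r /set_mem /=; rewrite in_itv /= => /iT rT.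
  apply: (@cvg_comp _ _ _ (fun r => (q, r)) f _ (nbhs (q, r))).
    by apply: (@cvg_pair _ _ _ _ (nbhs q) (nbhs r)); [exact: cvg_cst|exact: cvg_id].
  exact: f_continuous.
- by move=> r /=; rewrite in_itv /= => /iT; exact: f0.
- by rewrite /= in_itv /= ge_min lexx le_max lexx.
- by rewrite /= in_itv /= ge_min lexx orbT le_max lexx orbT.
Qed.

Lemma f_sign_neg p q s t : time s -> time t -> f (p, s) < 0 -> f (q, t) < 0.
Proof.
move=> sT tT fps; rewrite lt_neqAle f0 //= leNgt; apply/negP => fqt.
by have := f_sign p tT sT fqt; rewrite ltNge ltW.
Qed.

Variables q Q : R -> R.
Hypothesis cq : forall t, time t -> {for t, continuous q}.
Hypothesis QE : forall t1 t2, 0 < t1 -> t1 < t2 -> (t2%:E < Tstar)%E ->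
  Q t2 - Q t1 = \int[lebesgue_measure]_(t in `[t1, t2]) q t.

Lemma Q_is_derive t : time t -> is_derive t 1 Q (q t).
Proof.
move=> [t0 tT].
(* The compact interval [t / 2, b] around [t] stays inside the time range, so [q] is continuous on
   all of it. *)
have [b tb bT] : exists2 b : R, t < b & (b%:E < Tstar)%E.
  case: (Tstar) tT => [r| |] //=.
  - rewrite lte_fin => tr; exists ((t + r) / 2); rewrite ?lte_fin; lra.
  - by move=> _; exists (t + 1); rewrite ?ltry // ltrDl.
have I s : t / 2 <= s <= b -> time s.
  move=> /andP[s1 s2]; split; first lra.
  by apply: le_lt_trans bT; rewrite lee_fin.
apply: (@primitive_is_derive _ q Q (t / 2) b); first by apply/andP; split; lra.
- by move=> s /I; exact: cq.
- move=> s s' s1 ss' s'b; apply: QE => //; first lra.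
  by apply: le_lt_trans bT; rewrite lee_fin.
Qed.

Let dt p t := derive1 (fun s => f (p, s) : R^o) t.
Let df p t u := vdiff SM (fun q => f (q, t) : R^o) p u.

Let L (gam : R -> M) (s : R) : R := ln `|f (gam s, s)| + Q s.
Let L' (gam : R -> M) (s : R) : R :=
  (dt (gam s) s + df (gam s) s (velocity SM gam s)) / f (gam s, s) + q s.
Let density (gam : R -> M) (s : R) : R :=
  (f (gam s, s))^-1 * h (gam s, s) (velocity SM gam s) (velocity SM gam s).

Section AlongCurve.
Variables (V : set R) (gam : R -> M).
Hypotheses (oV : open V) (sg : smooth_on (@line R) SM V gam).

Lemma L_is_derive s : V s -> time s -> is_derive s 1 (L gam) (L' gam s).
Proof.
move=> Vs sT; have D := curve_is_derive HM ostrip sf oV sg Vs sT.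
have Dl := is_derive_ln_norm (f0 (gam s) sT) D.
exact: is_deriveD Dl (Q_is_derive sT).
Qed.

Lemma L'_continuous s : V s -> time s -> {for s, continuous (L' gam)}.
Proof.
move=> Vs sT.
have [V' [oV' V's] Ck1] := curve_C1 HM ostrip sf oV sg Vs sT.
have cphi : {for s, continuous (fun s => f (gam s, s))} := Ck1.1 s V's.
have cphi' := (Ck1.2 1).2.1 s V's.
have oJ : open [set t : R | time t] := @open_time_interval R Tstar.
have nJ : \forall r \near s, V r /\ time r.
  by apply: filterI; exact: open_nbhs_nbhs.
have H : ('D_1 (fun r : R^o => f (gam r, r) : R^o) r / f (gam r, r) + q r) @[r --> s] -->
    'D_1 (fun r : R^o => f (gam r, r) : R^o) s / f (gam s, s) + q s.
  apply: cvgD; last exact: cq.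
  by apply: cvgM; [exact: cphi'|apply: cvgV; [exact: f0|exact: cphi]].
apply: near_eq_continuous H; apply: filterS nJ => r [Vr rT].
by have [_ ->] := curve_is_derive HM ostrip sf oV sg Vr rT.
Qed.

Lemma integral_L' t1 t2 : 0 < t1 -> t1 < t2 -> (t2%:E < Tstar)%E ->
  `[t1, t2]%classic `<=` V ->
  (\int[lebesgue_measure]_(s in `[t1, t2]) (- 4 * L' gam s)%:E =
   (- 4 * (L gam t2 - L gam t1))%:E)%E.
Proof.
move=> t10 t12 t2T tV.
have I s : t1 <= s <= t2 -> V s /\ time s.
  move=> st; split; first by apply: tV; rewrite /= in_itv.
  move: st => /andP[s1 s2]; split; first lra.
  by apply: le_lt_trans t2T; rewrite lee_fin.
have dL s : t1 <= s <= t2 ->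
    is_derive s 1 (fun s => - 4 * L gam s) (- 4 * L' gam s).
  move=> /I[Vs sT]; have D := L_is_derive Vs sT.
  exact: (@is_deriveZ R R^o R^o (L gam) (- 4) s 1 (L' gam s) D).
have cL s : t1 <= s <= t2 -> {for s, continuous (fun s => - 4 * L' gam s)}.
  move=> /I[Vs sT]; apply: cvgM; first exact: cvg_cst.
  exact: L'_continuous.
by rewrite (FTC_segment t12 dL cL) mulrBr.
Qed.

Lemma L'_density_pos s : time s -> 0 < f (gam s, s) ->
  - q s <= harnack_quotient f h gradf (gam s) s ->
  - 4 * L' gam s <= density gam s.
Proof.
move=> sT fs; rewrite /harnack_quotient -/(dt _ _).
have := h_square (gam s) (gradf (gam s, s)) (velocity SM gam s) sT.
rewrite (Hgrad (gam s) (velocity SM gam s) sT) -/(df _ _ _) /L' /density.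
set H := h _ (gradf _) _; set D := df _ _ _; set B := h _ (velocity _ _ _) _.
set T := dt _ _; set p := f _ in fs *.
(* After clearing [p], [Hq] reads - q p <= T - H and [sq] reads 0 <= H + D + B / 4; their sum gives
   - 4 (T + D + q p) <= B. *)
rewrite ler_pdivlMr // => sq Hq; rewrite [leRHS]mulrC ler_pdivlMr //.
rewrite [leLHS](_ : _ = - 4 * (T + D + q s * p)); first lra.
by field; rewrite gt_eqF.
Qed.

Lemma L'_density_neg s : time s -> f (gam s, s) < 0 ->
  harnack_quotient f h gradf (gam s) s <= - q s ->
  density gam s <= - 4 * L' gam s.
Proof.
move=> sT fs; rewrite /harnack_quotient -/(dt _ _).
have := h_square (gam s) (gradf (gam s, s)) (velocity SM gam s) sT.
rewrite (Hgrad (gam s) (velocity SM gam s) sT) -/(df _ _ _) /L' /density.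
set H := h _ (gradf _) _; set D := df _ _ _; set B := h _ (velocity _ _ _) _.
set T := dt _ _; set p := f _ in fs *.
(* Multiplication by [p < 0] reverses both the hypothesis and the goal, so the arithmetic is that of
   the positive case. *)
rewrite ler_ndivrMr // => sq Hq; rewrite [leLHS]mulrC ler_ndivrMr //.
rewrite [leLHS](_ : _ = - 4 * (T + D + q s * p)); first lra.
by field; rewrite lt_eqF.
Qed.

End AlongCurve.

Lemma curves_open p1 p2 t1 t2 gam : t1 < t2 -> curves SM t1 t2 p1 p2 gam ->
  exists V : set R, [/\ open V, smooth_on (@line R) SM V gam &
                        `[t1, t2]%classic `<=` V].
Proof.
move=> t12 [_ _ [e e0 sg]]; exists [set s | t1 - e < s < t2 + e]; split=> //.
  by rewrite -set_itvoo; exact: itv_open.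
by move=> s /=; rewrite in_itv /= => /andP[s1 s2]; apply/andP; split; lra.
Qed.

Definition harnack_integrated : Prop :=
  forall (p1 p2 : M) t1 t2, 0 < t1 -> t1 < t2 -> (t2%:E < Tstar)%E ->
    ((f (p1, t1))%:E <= (expR (Q t2) / expR (Q t1))%:E *
     expeR (Delta SM f h p1 p2 t1 t2 * (4^-1)%:E) * (f (p2, t2))%:E)%E.

Lemma harnack_integrate :
  (forall p t, time t ->
     (0 < f (p, t) -> - q t <= harnack_quotient f h gradf p t) /\
     (f (p, t) < 0 -> harnack_quotient f h gradf p t <= - q t)) ->
  harnack_integrated.
Proof.
move=> Hq p1 p2 t1 t2 t10 t12 t2T.
have I s : t1 <= s <= t2 -> time s.
  move=> /andP[s1 s2]; split; first lra.
  by apply: le_lt_trans t2T; rewrite lee_fin.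
have t1T : time t1 by apply: I; rewrite lexx ltW.
have t2T' : time t2 by split=> //; exact: lt_trans t12.
(* The total change of [L] depends only on the end points, so it is a common bound for the energies
   of all competing curves. *)
have ends gam : curves SM t1 t2 p1 p2 gam ->
    - 4 * (L gam t2 - L gam t1) =
    - 4 * (ln `|f (p2, t2)| + Q t2 - (ln `|f (p1, t1)| + Q t1)).
  by rewrite /L => -[-> ->].
case: (ltrgt0P (f (p1, t1))) (f0 p1 t1T) => // f1 _.
- rewrite harnack_exp_pos //; last exact: f_sign f1.
  rewrite /Delta f1; apply: le_ereal_inf_tmp => _ [gam cg <-].
  have [V [oV sg tV]] := curves_open t12 cg.
  (* The number is written back as the integral of - 4 L', so that the pointwise bound can be
     integrated against the energy density. *)
  rewrite -(ends gam cg) -(integral_L' oV sg t10 t12 t2T tV).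
  apply: le_integral_nomeas => s /=; rewrite in_itv /= lee_fin => /I sT.
  have fs : 0 < f (gam s, s) by exact: f_sign f1.
  by apply: L'_density_pos => //; exact: (Hq _ _ sT).1.
- rewrite harnack_exp_neg //; last exact: f_sign_neg f1.
  rewrite /Delta ltNge (ltW f1) /=; apply: ge_ereal_sup => _ [gam cg <-].
  have [V [oV sg tV]] := curves_open t12 cg.
  rewrite -(ends gam cg) -(integral_L' oV sg t10 t12 t2T tV).
  apply: le_integral_nomeas => s /=; rewrite in_itv /= lee_fin => /I sT.
  have fs : f (gam s, s) < 0 by exact: f_sign_neg f1.
  by apply: L'_density_neg => //; exact: (Hq _ _ sT).2.
Qed.

Lemma harnack_differentiate : harnack_integrated ->
  forall p t, time t ->
    (0 < f (p, t) -> - q t <= harnack_quotient f h gradf p t) /\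
    (f (p, t) < 0 -> harnack_quotient f h gradf p t <= - q t).
Proof.
move=> HI p t tT.
(* In the preferred chart at [p] the map [tvec] is the identity there, so the curve starts with
   velocity exactly [w]; at later times only the components in [c] are [w]. *)
pose c := chart_at SM p; have Ac : atlas SM c := chart_at_atlas HM p.
have dp : dom c p := chart_at_dom HM p.
pose w := - 2 *: gradf (p, t).
pose gam := straight_curve c (coord c p) t w.
have cd : (coord c @` dom c) (coord c p) by exists p.
have [r r0 rP] := straight_near HM t w Ac cd.
pose V := [set s : R | t - r < s < t + r].
have oV : open V by rewrite /V -set_itvoo; exact: itv_open.
have Vt : V t by apply/andP; split; lra.
have sg : smooth_on (@line R) SM V gam by exact: straight_curve_smooth.
have gamt : gam t = p.
  by rewrite /gam /straight_curve straight0 inv_coord //; exact: (atlas_chart HM).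
have velt : velocity SM gam t = w.
  rewrite (straight_curve_velocity HM Ac rP Vt) -/gam gamt.
  exact: tvec_chart_at.
have hc := sff_straight_continuous HM HN gbil gsym _ LC ostrip sx snu _ Ac dp tT oV Vt rP.
have {}hc : {for t, continuous (fun s =>
     h (gam s, s) (velocity SM gam s) (velocity SM gam s))}.
  apply: hc; first by case: Hg.
  move=> c' d' p' t' w' t'T Ac' Ad' dp' dx'.
  exact: (sff_tvec fE fF HM HN gbil gsym (sxt t'T) sigma2
    (fun p => nuunit p t'T) (fun p u => nunormal p u t'T) (Hh t'T)).
have [V' [oV' V't] Ck1] := curve_C1 HM ostrip sf oV sg Vt (tT : strip (gam t, t)).
have cphi : {for t, continuous (fun s => f (gam s, s))} := Ck1.1 t V't.
have cB : {for t, continuous (density gam)}.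
  by apply: cvgM; [apply: cvgV; [exact: f0|exact: cphi]|exact: hc].
have D : is_derive t 1 (fun s => - 4 * L gam s) (- 4 * L' gam t).
  have DL := L_is_derive oV sg Vt tT.
  exact: (@is_deriveZ R R^o R^o (L gam) (- 4) t 1 (L' gam t) DL).
(* With the margin e = t + r - s the upper end s + e is t + r, and the lower end t - e = s - r lies
   above t - r because s > t. *)
have cur s : V s -> t < s -> curves SM t s p (gam s) gam.
  move=> /andP[s1 s2] ts; split=> //; exists (t + r - s); first lra.
  apply: smooth_on_sub sg => s' /= /andP[s1' s2'].
  by apply/andP; split; lra.
have nV : \forall s \near t, V s /\ (s%:E < Tstar)%E.
  apply: filterI; first exact: open_nbhs_nbhs.
  have oJ : open [set t : R | time t] := @open_time_interval R Tstar.
  by apply: filterS (open_nbhs_nbhs (conj oJ tT)) => s [].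
have ends s : - 4 * L gam s - - 4 * L gam t =
    - 4 * (ln `|f (gam s, s)| + Q s - (ln `|f (p, t)| + Q t)).
  by rewrite -mulrBr /L gamt.
have Bt : density gam t = 4 * h (p, t) (gradf (p, t)) (gradf (p, t)) / f (p, t).
  by rewrite /density velt gamt h_opp2 // mulrC.
have dfw : df p t w = - 2 * h (p, t) (gradf (p, t)) (gradf (p, t)).
  have hs := h_sym_form p tT.
  by rewrite /df -Hgrad // hs.2 sym_formZ.
have L't : L' gam t = (dt p t - 2 * h (p, t) (gradf (p, t)) (gradf (p, t))) / f (p, t) + q t.
  by rewrite /L' gamt velt dfw mulNr.
rewrite /harnack_quotient -/(dt _ _).
split=> ft.
- have : - 4 * L' gam t <= density gam t.
    apply: (derive_le_density D cB); apply: filterS nV => s [Vs sT] ts.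
    have sT' : time s by split=> //; exact: lt_trans tT.1 ts.
    rewrite ends; have := HI p (gam s) t s tT.1 ts sT.
    rewrite harnack_exp_pos //; last exact: f_sign ft.
    move=> /le_trans; apply; rewrite /Delta ft; apply: ereal_inf_lbound.
    by exists gam => //; exact: cur.
  (* Clearing [a] leaves - 4 (T - 2 H + q a) <= 4 H, that is - q a <= T - H. *)
  rewrite Bt L't; set T := dt _ _; set H := h _ _ _; set a := f _ in ft *.
  rewrite !ler_pdivlMr // => HH.
  rewrite [leLHS](_ : _ = - 4 * (T - 2 * H + q t * a)) in HH; first lra.
  by field; rewrite gt_eqF.
- have : density gam t <= - 4 * L' gam t.
    apply: (density_le_derive D cB); apply: filterS nV => s [Vs sT] ts.
    have sT' : time s by split=> //; exact: lt_trans tT.1 ts.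
    rewrite ends; have := HI p (gam s) t s tT.1 ts sT.
    rewrite harnack_exp_neg //; last exact: f_sign_neg ft.
    apply: le_trans; rewrite /Delta ltNge (ltW ft) /=; apply: ereal_sup_ubound.
    by exists gam => //; exact: cur.
  (* Since [a < 0], clearing it reverses hypothesis and goal, and again - q a <= T - H. *)
  rewrite Bt L't; set T := dt _ _; set H := h _ _ _; set a := f _ in ft *.
  rewrite !ler_ndivrMr // => HH.
  rewrite [leLHS](_ : _ = - 4 * (T - 2 * H + q t * a)) in HH; first lra.
  by field; rewrite lt_eqF.
Qed.

End Harnack.

(** * The equivalence for general q, and the case q = k / t *)

Theorem theorem1p10 (R : realType) (n : nat)
  (N : topologicalType) (SN : smooth_structure 'rV[R]_n.+1 N)
  (gbar : N -> 'rV[R]_n.+1 -> 'rV[R]_n.+1 -> R)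
  (Gbar : chart 'rV[R]_n.+1 N ->
          'rV[R]_n.+1 -> 'rV[R]_n.+1 -> 'rV[R]_n.+1 -> 'rV[R]_n.+1)
  (HN : is_smooth_manifold SN)
  (Hgbar : is_semi_riemannian SN gbar)
  (HGbar : is_levi_civita SN gbar Gbar)
  (M : topologicalType) (SM : smooth_structure 'rV[R]_n M)
  (HM : is_smooth_manifold SM)
  (Mconn : connected [set: M])
  (Morient : orientable SM)
  (Tstar : \bar R) (HT : (0 < Tstar)%E)
  (x : M * R -> N)
  (xsmooth : smooth_on (prod_structure SM line) SN
               [set pt | 0 < pt.2 /\ (pt.2%:E < Tstar)%E] x)
  (xemb : forall t, 0 < t -> (t%:E < Tstar)%E ->
            is_embedding SM SN (fun p => x (p, t)))
  (G : R -> chart 'rV[R]_n M -> 'rV[R]_n -> 'rV[R]_n -> 'rV[R]_n -> 'rV[R]_n)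
  (HG : forall t, 0 < t -> (t%:E < Tstar)%E ->
          is_levi_civita SM (pullback_metric SM SN gbar (fun p => x (p, t)))
            (G t))
  (Mcomplete : forall t, 0 < t -> (t%:E < Tstar)%E ->
                 geodesically_complete SM (G t))
  (sigma : R) (Hsigma : sigma = 1 \/ sigma = -1)
  (nu : M * R -> 'rV[R]_n.+1)
  (nusmooth : smooth_field_on (prod_structure SM line) SN
                [set pt | 0 < pt.2 /\ (pt.2%:E < Tstar)%E] x nu)
  (nuunit : forall p t, 0 < t -> (t%:E < Tstar)%E ->
              gbar (x (p, t)) (nu (p, t)) (nu (p, t)) = sigma)
  (nunormal : forall p t u, 0 < t -> (t%:E < Tstar)%E ->
      gbar (x (p, t)) (nu (p, t)) (mdiff SM SN (fun q => x (q, t)) p u) = 0)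
  (h : M * R -> 'rV[R]_n -> 'rV[R]_n -> R)
  (Hh : forall t, 0 < t -> (t%:E < Tstar)%E ->
          is_second_fundamental_form SM SN (G t) Gbar (fun p => x (p, t))
            (fun p => nu (p, t)) sigma (fun p => h (p, t)))
  (hconvex : forall p t u, 0 < t -> (t%:E < Tstar)%E -> u != 0 ->
               0 < h (p, t) u u)
  (f : M * R -> R)
  (fsmooth : smooth_on (prod_structure SM line) line
               [set pt | 0 < pt.2 /\ (pt.2%:E < Tstar)%E] f)
  (fneq0 : forall p t, 0 < t -> (t%:E < Tstar)%E -> f (p, t) != 0)
  (flow : forall p t, 0 < t -> (t%:E < Tstar)%E ->
            velocity SN (fun s => x (p, s)) t =
            - (sigma * f (p, t)) *: nu (p, t))
  (gradf : M * R -> 'rV[R]_n)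
  (Hgradf : forall p t u, 0 < t -> (t%:E < Tstar)%E ->
      h (p, t) (gradf (p, t)) u =
      vdiff SM (fun q => f (q, t) : R^o) p u) :
  (forall q Q : R -> R,
     (forall t, 0 < t -> (t%:E < Tstar)%E -> {for t, continuous q}) ->
     (forall t1 t2, 0 < t1 -> t1 < t2 -> (t2%:E < Tstar)%E ->
        Q t2 - Q t1 = \int[lebesgue_measure]_(t in `[t1, t2]) q t) ->
     (forall p t, 0 < t -> (t%:E < Tstar)%E ->
        (0 < f (p, t) -> harnack_quotient f h gradf p t >= - q t) /\
        (f (p, t) < 0 -> harnack_quotient f h gradf p t <= - q t))
     <->
     (forall (p1 p2 : M) t1 t2, 0 < t1 -> t1 < t2 -> (t2%:E < Tstar)%E ->
        ((f (p1, t1))%:E <=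
         (expR (Q t2) / expR (Q t1))%:E *
         expeR (Delta SM f h p1 p2 t1 t2 * (4^-1)%:E) *
         (f (p2, t2))%:E)%E))
  /\
  (forall a : R, a != -1 ->
     (forall p t, 0 < t -> (t%:E < Tstar)%E -> 0 < f (p, t)) ->
     (forall p t, 0 < t -> (t%:E < Tstar)%E ->
        harnack_quotient f h gradf p t >= - (a / (a + 1) * t^-1))
     <->
     (forall (p1 p2 : M) t1 t2, 0 < t1 -> t1 < t2 -> (t2%:E < Tstar)%E ->
        ((f (p1, t1))%:E <=
         ((t2 / t1) `^ (a / (a + 1)))%:E *
         expeR (Delta SM f h p1 p2 t1 t2 * (4^-1)%:E) *
         (f (p2, t2))%:E)%E)).
Proof.
have sigma2 : sigma * sigma = 1 by case: Hsigma => ->; rewrite ?mulrNN mulr1.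
have sxt t : 0 < t /\ (t%:E < Tstar)%E -> smooth_on SM SN setT (fun p => x (p, t)).
  by move=> [t0 tT]; case: (xemb t t0 tT).
have nuunit' p t (tT : 0 < t /\ (t%:E < Tstar)%E) := nuunit p t tT.1 tT.2.
have nunormal' p t u (tT : 0 < t /\ (t%:E < Tstar)%E) := nunormal p t u tT.1 tT.2.
have Hh' t (tT : 0 < t /\ (t%:E < Tstar)%E) := Hh t tT.1 tT.2.
have hconvex' p t u (tT : 0 < t /\ (t%:E < Tstar)%E) := hconvex p t u tT.1 tT.2.
have fneq0' p t (tT : 0 < t /\ (t%:E < Tstar)%E) := fneq0 p t tT.1 tT.2.
have Hgradf' p t u (tT : 0 < t /\ (t%:E < Tstar)%E) := Hgradf p t u tT.1 tT.2.
have main q Q :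
    (forall t, 0 < t -> (t%:E < Tstar)%E -> {for t, continuous q}) ->
    (forall t1 t2, 0 < t1 -> t1 < t2 -> (t2%:E < Tstar)%E ->
       Q t2 - Q t1 = \int[lebesgue_measure]_(t in `[t1, t2]) q t) ->
    (forall p t, 0 < t /\ (t%:E < Tstar)%E ->
       (0 < f (p, t) -> - q t <= harnack_quotient f h gradf p t) /\
       (f (p, t) < 0 -> harnack_quotient f h gradf p t <= - q t)) <->
    harnack_integrated SM Tstar h f Q.
  move=> cq QE; have cq' t (tT : 0 < t /\ (t%:E < Tstar)%E) := cq t tT.1 tT.2.
  split.
    exact: (harnack_integrate HM HN Hgbar HGbar Mconn sxt sigma2 nuunit' nunormal'
      Hh' hconvex' fsmooth fneq0' Hgradf' cq' QE).
  exact: (harnack_differentiate HM HN Hgbar HGbar Mconn xsmooth sxt sigma2 nusmooth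
    nuunit' nunormal' Hh' fsmooth fneq0' Hgradf' cq' QE).
split=> [q Q cq QE|a a1 fpos].
  have [fwd bwd] := main q Q cq QE; split=> H; first by apply: fwd => p t [t0 tT]; exact: H.
  by move=> p t t0 tT; exact: bwd H p t (conj t0 tT).
set k := a / (a + 1).
(* For t > 0, k ln t is a primitive of k / t, and exp (Q t2 - Q t1) is the power (t2 / t1)^k. *)
pose q (t : R) := k * t^-1; pose Q (t : R) := k * ln t.
have cq (t : R) : 0 < t -> {for t, continuous q}.
  move=> t0; apply: cvgM; first exact: cvg_cst.
  by apply: cvgV; [rewrite gt_eqF|exact: cvg_id].
have QE (t1 t2 : R) : 0 < t1 -> t1 < t2 ->
    Q t2 - Q t1 = \int[lebesgue_measure]_(t in `[t1, t2]) q t.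
  move=> t10 t12; rewrite /Rintegral.
  have dQ (s : R) : t1 <= s <= t2 -> is_derive s 1 Q (q s).
    move=> /andP[s1 _]; have s0 : 0 < s by exact: lt_le_trans s1.
    exact: (@is_deriveZ R R^o R^o (@ln R) k s 1 s^-1 (is_derive1_ln s0)).
  rewrite (FTC_segment t12 dQ) // => s /andP[s1 _].
  by apply: cq; exact: lt_le_trans s1.
have powE (t1 t2 : R) : 0 < t1 -> t1 < t2 ->
    (t2 / t1) `^ k = expR (Q t2) / expR (Q t1).
  move=> t10 t12; have t20 := lt_trans t10 t12.
  by rewrite /powR gt_eqF ?divr_gt0 // ln_div ?posrE // -expRN -expRD mulrBr.
have [fwd bwd] := main q Q (fun t t0 _ => cq t t0) (fun t1 t2 t10 t12 _ => QE t1 t2 t10 t12).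
split=> H.
  move=> p1 p2 t1 t2 t10 t12 t2T; rewrite powE //; apply: fwd => // p t [t0 tT].
  (* Positivity of f makes the half for negative values vacuous. *)
  by split=> [_|]; [exact: H|rewrite ltNge ltW // fpos].
move=> p t t0 tT; apply: (bwd _ p t (conj t0 tT)).1; last exact: fpos.
by move=> p1 p2 t1 t2 t10 t12 t2T; rewrite -powE //; exact: H.
Qed.
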